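(* Let $G=\ast_{j\in J} A_j$ be a free product of nontrivial groups and let $n$ be a positive integer. If $N\in\{N(g)\mid g\in\hat G\}$, then $$k(G,n,N) = \left\lfloor \frac{n}{2}\right\rfloor - \left\lfloor \frac{n}{N}\right\rfloor + 1.$$
   Context: For a group $G$ with a fixed free-product decomposition $G=\ast_{j\in J} A_j$, let $\hat G$ be the set of elements of $G$ not conjugate to elements of any free factor $A_j$. For $g\in\hat G$ with cyclically reduced form $a_{j_1,1}a_{j_2,2}\cdots a_{j_m,m}$ (with $a_{j_i,i}\in A_{j_i}$ nonidentity, consecutive letters in different factors, including cyclically), $N(g)$ denotes the minimal order of the letters $a_{j_1,1},\dots,a_{j_m,m}$ (possibly $\infty$). For $N\in\{N(g)\mid g\in\hat G\}$, $k(G,n,N)$ is the minimal number $k$ such that some element $g^n\in\hat G$ with $N(g)=N$ can be written as a product of $k$ commutators, where $[x,y]=x^{-1}y^{-1}xy$. If $N=\infty$, the term $\lfloor n/N\rfloor$ is interpreted as $0$. $\lfloor x\rfloor$ denotes the integer part of $x$. *)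

(* Defs.v *)
From HB Require Import structures.
From mathcomp Require Import all_boot.
From mathcomp Require Import monoid.
From Stdlib Require List.

Set Implicit Arguments.
Unset Strict Implicit.
Unset Printing Implicit Defensive.

Local Open Scope group_scope.

(* Orders of group elements: [Some m] = finite order m (m > 0), [None] = infinite. *)
Definition elt_order (A : groupType) (a : A) (o : option nat) : Prop :=
  match o with
  | Some m => (0 < m)%N /\ a ^+ m = 1 /\ forall k, (0 < k)%N -> a ^+ k = 1 -> (m <= k)%N
  | None => forall k, (0 < k)%N -> a ^+ k <> 1
  end.

Definition ole (o1 o2 : option nat) : Prop :=
  match o1, o2 with
  | Some a, Some b => (a <= b)%N
  | _, None => True
  | None, Some _ => False
  end.

Definition ofloor_div (n : nat) (o : option nat) : nat :=
  match o with Some m => (n %/ m)%N | None => 0%N end.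

Definition is_free_product (J : Type) (A : J -> groupType) (G : groupType)
  (iota : forall j, A j -> G) : Prop :=
  (forall j, monoid_morphism (iota j)) /\
  forall (H : groupType) (f : forall j, A j -> H),
    (forall j, monoid_morphism (f j)) ->
    exists phi : G -> H,
      (monoid_morphism phi /\ forall j a, phi (iota j a) = f j a) /\
      forall psi : G -> H, monoid_morphism psi -> (forall j a, psi (iota j a) = f j a) ->
        forall x, psi x = phi x.

Definition conjugate (G : groupType) (x y : G) : Prop := exists h : G, x = y ^ h.

Definition in_Ghat (J : Type) (A : J -> groupType) (G : groupType)
  (iota : forall j, A j -> G) (g : G) : Prop :=
  forall j (a : A j), ~ conjugate g (iota j a).

Fixpoint alt_chain (J : Type) (A : J -> groupType) (w : seq {j : J & A j}) : Prop :=
  match w with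
  | x :: ((y :: _) as t) => tag x <> tag y /\ alt_chain t
  | _ => True
  end.

Definition cyclically_reduced (J : Type) (A : J -> groupType) (w : seq {j : J & A j}) : Prop :=
  (2 <= size w)%N /\
  (forall x, List.In x w -> tagged x <> 1) /\
  alt_chain w /\
  match w with x :: _ => tag (last x w) <> tag x | [::] => True end.

Definition eval_word (J : Type) (A : J -> groupType) (G : groupType)
  (iota : forall j, A j -> G) (w : seq {j : J & A j}) : G :=
  foldr (fun x acc => iota (tag x) (tagged x) * acc) 1 w.

Definition NG (J : Type) (A : J -> groupType) (G : groupType)
  (iota : forall j, A j -> G) (g : G) (N : option nat) : Prop :=
  in_Ghat iota g /\
  exists w : seq {j : J & A j},
    cyclically_reduced w /\ conjugate g (eval_word iota w) /\
    (exists x, List.In x w /\ elt_order (tagged x) N) /\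
    (forall x o, List.In x w -> elt_order (tagged x) o -> ole N o).

(* x is a product of k commutators [a,b] = a^-1 b^-1 a b. *)
Definition prod_commutators (G : groupType) (x : G) (k : nat) : Prop :=
  exists s : seq (G * G), size s = k /\
    x = foldr (fun p acc => [~ p.1, p.2] * acc) 1 s.

Definition is_kGnN (J : Type) (A : J -> groupType) (G : groupType)
  (iota : forall j, A j -> G) (n : nat) (N : option nat) (K : nat) : Prop :=
  (exists g : G, NG iota g N /\ in_Ghat iota (g ^+ n) /\ prod_commutators (g ^+ n) K) /\
  (forall (g : G) (k : nat), NG iota g N -> in_Ghat iota (g ^+ n) ->
     prod_commutators (g ^+ n) k -> (K <= k)%N).

(* Main.v *)
(** Lower bound. If [g ^+ n] is a product of [k] commutators, a surface of genus [k] with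
one boundary component reading [w ^ n] decomposes into pieces mapped to the free factors
and central pieces mapped to the base point; combinatorially the pieces are the orbits of
two permutations of the [n * m] letters, and an orbit with trivial product is a disc.
Such structures survive the elementary moves on words, hence only depend on the element
of [G] that is read. To bound the number of discs, number the letters of the period by
[0 .. m-1] and look at the steps along the pieces. A step ascends or not, and is low or
high according to the sum of its two indices. In total there are [n * m - n] ascents,
and among the low steps, as among the high ones, there are exactly [n] more descents than
ascents. In a piece with non-constant index the ascents exceed, by at least one, the sum
of its excess of low ascents over low descents and of high ascents over high descents,
while a constant disc carries at least [N] descents, all low or all high. Hence there are
at most [n * m - n + 2 * (n %/ N)] discs, which bounds the Euler characteristic.

Upper bound. With [g = [a, b]] and [a ^+ N = 1], cutting a handle merges three consecutive
factors [a^-s a^t^b] of [g ^+ n] into one, and exponents that reach [N] cancel for free. *)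

Require Import Defs.
From HB Require Import structures.
From mathcomp Require Import all_boot.
From mathcomp Require Import monoid fingroup perm generic_quotient.
From mathcomp Require Import boolp zify.

Set Implicit Arguments.
Unset Strict Implicit.
Unset Printing Implicit Defensive.

Local Open Scope group_scope.
Local Open Scope quotient_scope.

(** * Powers of a commutator *)

Section UpperBound.
Variable G : groupType.
Implicit Types (a b g u v x y z : G) (k l m n N p q r : nat).

Let gsimp := (@invgM G, @invgK G, @mulKg G, @mulVKg G, @mulgK G, @mulgVK G,
              @mulgV G, @mulVg G, @mulg1 G, @mul1g G, @invg1 G).

Lemma prod_commutators0 : prod_commutators (1 : G) 0.
Proof. by exists [::]. Qed.

Lemma prod_commutators_mul x y k l :
  prod_commutators x k -> prod_commutators y l -> prod_commutators (x * y) (k + l).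
Proof.
move=> [s [<- ->]] [t [<- ->]]; exists (s ++ t); split; first exact: size_cat.
by elim: s => [|c s IHs] /=; rewrite ?mul1g // -IHs mulgA.
Qed.

Lemma prod_commutators1 x y : prod_commutators [~ x, y] 1.
Proof. by exists [:: (x, y)]; split=> //=; rewrite mulg1. Qed.

Lemma prod_commutators_conj x z k :
  prod_commutators x k -> prod_commutators (x ^ z) k.
Proof.
move=> [s [<- ->]]; exists [seq (c.1 ^ z, c.2 ^ z) | c <- s].
split; first exact: size_map.
by elim: s => [|c s IHs] /=; rewrite ?conj1g // conjMg conjRg IHs.
Qed.

Lemma prod_commutators_conjV x z k :
  prod_commutators (x ^ z) k -> prod_commutators x k.
Proof. by rewrite -{2}[x](conjgK z); apply: prod_commutators_conj. Qed.

Lemma prod_commutators_leq x k l :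
  (k <= l)%N -> prod_commutators x k -> prod_commutators x l.
Proof.
move=> /subnKC <- xk; rewrite -[x]mulg1; apply: prod_commutators_mul => //.
elim: (l - k)%N => [|i IHi]; first exact: prod_commutators0.
rewrite -addn1 -[1]mulg1 -{2}(comm1g 1).
exact/prod_commutators_mul/prod_commutators1.
Qed.

(** Equality up to [k] commutators written on the left. As these may be conjugated past other
    factors, costs add up under products and commutators can be extracted anywhere in a word. *)
Definition comm_eq k u v := exists2 c, prod_commutators c k & u = c * v.

Lemma comm_eq_refl u : comm_eq 0 u u.
Proof. by exists 1; rewrite ?mul1g //; apply: prod_commutators0. Qed.

Lemma comm_eq_trans k l u v x : comm_eq k u v -> comm_eq l v x -> comm_eq (k + l) u x.
Proof.
move=> [c ck ->] [d dl ->]; exists (c * d); last by rewrite mulgA.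
exact: prod_commutators_mul.
Qed.

Lemma comm_eq_mul k l u v x y :
  comm_eq k u v -> comm_eq l x y -> comm_eq (k + l) (u * x) (v * y).
Proof.
move=> [c ck ->] [d dl ->]; exists (c * d ^ v^-1); last by rewrite conjgE !(gsimp, mulgA).
exact/prod_commutators_mul/prod_commutators_conj.
Qed.

Lemma comm_eq_exp k u v n : comm_eq k u v -> comm_eq (n * k) (u ^+ n) (v ^+ n).
Proof.
move=> uv; elim: n => [|n IHn]; first exact: comm_eq_refl.
by rewrite !expgS mulSn; apply: comm_eq_mul.
Qed.

Lemma prod_commutators_eq k l u v :
  comm_eq k u v -> prod_commutators v l -> prod_commutators u (k + l).
Proof. by move=> [c ck ->]; apply: prod_commutators_mul. Qed.

(* Cutting the surface along a pair of linked edges [x], [y] removes one handle. *)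
Lemma handle A B C D E x y :
  comm_eq 1 (A * x * B * y * C * x^-1 * D * y^-1 * E) (A * D * C * B * E).
Proof.
exists ([~ x^-1 * D * C, (B * y * C)^-1] ^ (A * D * C)^-1).
  exact/prod_commutators_conj/prod_commutators1.
by rewrite conjgE /commg /conjg !(gsimp, mulgA).
Qed.

(** * Merging the factors of a power of a commutator *)

Section Laps.
Variables a b : G.

(** For [i = j] this is a commutator. The two exponents are kept apart because torsion may kill one
    of them and not the other. *)
Definition lap i j := a ^- i * b^-1 * a ^+ j * b.

Lemma lap_comm i : lap i i = [~ a ^+ i, b].
Proof. by rewrite /lap /commg /conjg !mulgA. Qed.

(** The linked pairs are the first [b^-1] with the second [b], and the first [b] with the third
    [b^-1]. *)
Lemma lap3 i1 j1 i2 j2 i3 j3 :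
  comm_eq 1 (lap i1 j1 * lap i2 j2 * lap i3 j3) (lap (i1 + i2 + i3) (j1 + j2 + j3)).
Proof.
have := handle (a ^- i1) (a ^+ j1) (a ^- i2 * b^-1 * a ^+ j2) (a ^- i3) (a ^+ j3 * b) b^-1 b.
rewrite invgK /lap !mulgA.
congr (comm_eq 1 _ _).
have -> : (i1 + i2 + i3 = i2 + i3 + i1)%N by lia.
by rewrite (addnC j1) !expgnDr !invgM !mulgA.
Qed.

(** The first [b] is now paired with the fourth [b^-1], so the third factor survives and the
    exponents are collected in two groups. *)
Lemma lap4 i1 j1 i2 j2 i3 j3 i4 j4 :
  comm_eq 1 (lap i1 j1 * lap i2 j2 * lap i3 j3 * lap i4 j4)
            (lap (i1 + i3) j3 * lap (i2 + i4) (j1 + j2 + j4)).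
Proof.
have := handle (a ^- i1) (a ^+ j1) (a ^- i2 * b^-1 * a ^+ j2)
  (a ^- i3 * b^-1 * a ^+ j3 * b * a ^- i4) (a ^+ j4 * b) b^-1 b.
rewrite invgK /lap !mulgA.
congr (comm_eq 1 _ _).
by rewrite (addnC i1) (addnC j1) !expgnDr !invgM !mulgA.
Qed.

(** Torsion leaves [b^-1] next to [b], so the first factor shrinks to a power of [a] and joins its
    neighbour at no cost. *)
Lemma lap_zero_r N i1 i2 j2 : a ^+ N = 1 -> lap i1 N * lap i2 j2 = lap (i1 + i2) j2.
Proof.
move=> aN; rewrite /lap aN mulg1 !(gsimp, mulgA).
by rewrite -invgM -expgnDr addnC.
Qed.

Lemma lap_zero_l N i1 j1 j2 : a ^+ N = 1 -> lap i1 j1 * lap N j2 = lap i1 (j1 + j2).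
Proof.
by move=> aN; rewrite /lap aN invg1 mul1g !mulgA !gsimp expgnDr !mulgA.
Qed.

Lemma comm_pow_doubleS i p : comm_eq p ([~ a ^+ i, b] ^+ p.*2.+1) [~ a ^+ (i * p.*2.+1), b].
Proof.
elim: p => [|p IHp]; first by rewrite muln1; apply: comm_eq_refl.
rewrite doubleS -[p.*2.+3]/(1 + 1 + p.*2.+1)%N !expgnDr !expg1 -[p.+1]addn1.
apply: (comm_eq_trans (v := lap i i * lap i i * lap (i * p.*2.+1) (i * p.*2.+1))).
  rewrite -[p]add0n; apply: comm_eq_mul; last by rewrite lap_comm.
  by rewrite lap_comm; apply: comm_eq_refl.
by rewrite -lap_comm !mulnDr !muln1; apply: lap3.
Qed.
 
Lemma comm_pow_odd m : odd m -> comm_eq m./2 ([~ a, b] ^+ m) [~ a ^+ m, b].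
Proof.
move=> m_odd; have := comm_pow_doubleS 1 m./2; rewrite mul1n expg1.
by have -> : m./2.*2.+1 = m by lia.
Qed.

(* The five windows [1, 1, m - N - 1, N - 2, 1] are chosen so that [lap4] makes
   first one exponent and then a second one equal to [N]. *)
Lemma comm_pow_odd_torsion N m :
  a ^+ N = 1 -> odd N -> odd m -> (N < m < N.*2)%N ->
  comm_eq m./2.-1 ([~ a, b] ^+ m) [~ a ^+ m, b].
Proof.
move=> aN oddN oddm /andP[ltNm ltm2N].
have W w : odd w -> comm_eq w./2 ([~ a, b] ^+ w) (lap w w).
  by rewrite lap_comm; apply: comm_pow_odd.
have -> : (m./2.-1 = 0 + 0 + (m - N - 1)./2 + (N - 2)./2 + 0 + (1 + 0))%N by lia.
have -> : [~ a, b] ^+ m = [~ a, b] ^+ (1 + 1 + (m - N - 1) + (N - 2) + 1).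
  by congr (_ ^+ _); lia.
have -> : [~ a ^+ m, b] = [~ a ^+ (m - N), b].
  by rewrite -{1}(subnKC (ltnW ltNm)) expgnDr aN mul1g.
have W1 := W 1%N isT.
have [W3 W4] : comm_eq (m - N - 1)./2 ([~ a, b] ^+ (m - N - 1)) (lap (m - N - 1) (m - N - 1))
    /\ comm_eq (N - 2)./2 ([~ a, b] ^+ (N - 2)) (lap (N - 2) (N - 2)).
  by split; apply: W; lia.
rewrite !expgnDr; apply: comm_eq_trans.
  exact: comm_eq_mul (comm_eq_mul (comm_eq_mul (comm_eq_mul W1 W1) W3) W4) W1.
rewrite -lap_comm.
have -> : lap (m - N) (m - N) =
    lap (1 + (m - N - 1)) (m - N - 1) * lap (1 + (N - 2)) (1 + 1 + (N - 2)) * lap 1 1.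
  have -> : (1 + 1 + (N - 2) = N)%N by lia.
  rewrite -mulgA lap_zero_r //.
  have -> : (1 + (N - 2) + 1 = N)%N by lia.
  by rewrite lap_zero_l //; congr lap; lia.
by apply: comm_eq_mul (lap4 _ _ _ _ _ _ _ _) (comm_eq_refl _).
Qed.

End Laps.

(** * Fusing opposite powers into one commutator *)

Lemma commVg x b : [~ x^-1, b] = [~ x, b]^-1 ^ x^-1.
Proof. by rewrite invgR /commg /conjg !(gsimp, mulgA). Qed.

(** Since [[~ x^-1, b]] is the conjugate by [x^-1] of the inverse of [[~ x, b]], the product has the
    form [y * y^-1 ^ x^-1]. *)
Lemma comm_pow_inv x b p :
  prod_commutators ([~ x, b] ^+ p * [~ x^-1, b] ^+ p) 1.
Proof.
rewrite commVg -conjXg expVgn; set y := _ ^+ p.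
have -> : y * y^-1 ^ x^-1 = [~ y^-1, x^-1] by rewrite /commg /conjg !(gsimp, mulgA).
exact: prod_commutators1.
Qed.

Lemma comm_powS_inv x b p :
  prod_commutators ([~ x, b] ^+ p.+1 * [~ x^-1, b] ^+ p) 1.
Proof.
rewrite commVg -conjXg expVgn expgSr; set y := _ ^+ p.
pose Z := y * x^-1 * b^-1.
have -> : y * [~ x, b] * y^-1 ^ x^-1 = [~ x, Z^-1] ^ x^-1.
  by rewrite /Z /commg /conjg !(gsimp, mulgA).
exact/prod_commutators_conj/prod_commutators1.
Qed.

(** Used when [n] is an odd multiple of an odd [N], with [x = u = a] and [v = a ^+ (N - 2)]. *)
Lemma comm_pow_three x u v b p :
  commute x v -> u = (x * v)^-1 ->
  prod_commutators ([~ x, b] ^+ p.+1 * [~ v, b] * [~ x^-1, b] ^+ p * [~ u, b]) 1.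
Proof.
move=> xv ->; rewrite commVg -conjXg expVgn expgSr; set y := _ ^+ p.
pose K := b * x * y^-1 * b^-1; pose B := b * v * b^-1 * v^-1 * x^-1.
have vxv z : z * v^-1 * x * v = z * x by rewrite -!mulgA xv mulKg.
suff -> : y * [~ x, b] * [~ v, b] * y^-1 ^ x^-1 * [~ (x * v)^-1, b] = [~ v * K, B] ^ b.
  exact/prod_commutators_conj/prod_commutators1.
by rewrite /K /B /commg /conjg !(gsimp, mulgA) vxv.
Qed.

(** The power of [g] is cut into windows of lengths [m1] and [m2]. Whatever their number, the
    resulting opposite commutators fuse into one, hence the final [+ 1]. *)
Lemma comm_pow_split x b g m1 m2 k1 k2 p :
  comm_eq k1 (g ^+ m1) [~ x, b] -> comm_eq k2 (g ^+ m2) [~ x^-1, b] ->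
  prod_commutators (g ^+ (m1 * p + m2 * p)) (p * k1 + p * k2 + 1) /\
  prod_commutators (g ^+ (m1 * p.+1 + m2 * p)) (p.+1 * k1 + p * k2 + 1).
Proof.
move=> g1 g2; rewrite !expgnDr !expgnA.
split; apply: prod_commutators_eq (comm_eq_mul (comm_eq_exp _ g1) (comm_eq_exp _ g2)) _.
  exact: comm_pow_inv.
exact: comm_powS_inv.
Qed.

Lemma comm_pow_infinite a b n : (0 < n)%N -> prod_commutators ([~ a, b] ^+ n) (n %/ 2 + 1).
Proof.
have Odd m : odd m -> prod_commutators ([~ a, b] ^+ m) (m %/ 2 + 1).
  move=> m_odd; rewrite divn2.
  exact: prod_commutators_eq (comm_pow_odd a b m_odd) (prod_commutators1 _ _).
case: n => // n _; have [/Odd//|/= n_odd] := boolP (odd n.+1).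
rewrite expgSr; have -> : (n.+1 %/ 2 + 1 = n %/ 2 + 1 + 1)%N by lia.
by apply: prod_commutators_mul (prod_commutators1 _ _); apply: Odd; lia.
Qed.

Lemma expg_inv_torsion a N r s : a ^+ N = 1 -> (N %| r + s)%N -> a ^+ s = (a ^+ r)^-1.
Proof.
move=> aN /dvdnP[c rs]; apply/esym/mulg1_eq.
by rewrite -expgnDr rs mulnC expgnA aN expg1n.
Qed.

Lemma comm_pow_torsion_odd a b N q r : a ^+ N = 1 -> (1 < N)%N -> (r < N)%N ->
  odd (q * N + r) ->
  prod_commutators ([~ a, b] ^+ (q * N + r)) ((q * N + r) %/ 2 - q + 1).
Proof.
move=> aN N_gt1 r_lt n_odd; set y := [~ a, b].
have [d NE] : exists d, N = (r + d)%N by exists (N - r)%N; lia.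
(* This covers three of the four cases. As [N] divides [m1 + m2], the second kind of window gives
   commutators of [a ^- m1]. The windows are [r] and [N - r] for even [N], [r] and [2 * N - r] for
   odd [N] and even [q], and [N + r] and [N - r] for odd [N] and [q] with [r > 0]. *)
have split k1 k2 m1 m2 p : comm_eq k1 (y ^+ m1) [~ a ^+ m1, b] ->
    comm_eq k2 (y ^+ m2) [~ a ^+ m2, b] -> (N %| m1 + m2)%N ->
    (q * N + r = m1 * p.+1 + m2 * p)%N ->
    (p.+1 * k1 + p * k2 <= (q * N + r) %/ 2 - q)%N ->
    prod_commutators (y ^+ (q * N + r)) ((q * N + r) %/ 2 - q + 1).
  move=> y1 y2 dvd -> le; rewrite (expg_inv_torsion aN dvd) in y2.
  have [_ ] := comm_pow_split p y1 y2; apply: prod_commutators_leq.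
  by rewrite leq_add2r.
have [N_odd|N_even] := boolP (odd N); last first.
  have r_odd : odd r by move: n_odd; rewrite oddD oddM (negbTE N_even) andbF.
  have d_odd : odd d by lia.
  apply: (split _ _ r d q (comm_pow_odd a b r_odd) (comm_pow_odd a b d_odd)).
  - by rewrite NE.
  - rewrite NE; lia.
  - have [r' rE] : exists r', r = r'.*2.+1 by exists r./2; lia.
    have [d' dE] : exists d', d = d'.*2.+1 by exists d./2; lia.
    have [-> ->] : (r./2 = r' /\ d./2 = d')%N by lia.
    rewrite NE rE dE; lia.
have [q_odd|q_even] := boolP (odd q); last first.
  have [p qE] : exists p, q = p.*2 by exists q./2; lia.
  have r_odd : odd r by move: n_odd; rewrite oddD oddM (negbTE q_even).
  have m_odd : odd (N + d) by lia.
  have lem : (N < N + d < N.*2)%N by lia.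
  apply: (split _ _ r (N + d)%N p (comm_pow_odd a b r_odd)
           (comm_pow_odd_torsion b aN N_odd m_odd lem)).
  - rewrite addnCA -NE; exact/dvdn_add.
  - rewrite qE NE; lia.
  - have [r' rE] : exists r', r = r'.*2.+1 by exists r./2; lia.
    have [d' dE] : exists d', d = d'.*2 by exists d./2; lia.
    have -> : ((N + d)./2.-1 = r' + d'.*2 - 1)%N by lia.
    have -> : (r./2 = r')%N by lia.
    have : (0 < d')%N by lia.
    case: d' dE => // d' dE _; rewrite qE NE rE dE; lia.
have [p qE] : exists p, q = p.*2.+1 by exists q./2; lia.
have [r0|r_gt0] := posnP r.
  have [e eE] : exists e, N = e.*2.+3 by exists (N - 3)./2; lia.
  have N2_odd : odd (N - 2) by lia.
  have m_odd : odd (N.*2.-1) by lia.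
  have lem : (N < N.*2.-1 < N.*2)%N by lia.
  have y' := comm_pow_odd_torsion b aN N_odd m_odd lem.
  have dvd : (N %| 1 + N.*2.-1)%N.
    by rewrite (_ : 1 + N.*2.-1 = 2 * N)%N ?dvdn_mull //; lia.
  rewrite (expg_inv_torsion aN dvd) expg1 in y'.
  have v := comm_pow_odd a b N2_odd.
  (* The exponent [(2 * p + 1) * N] is split as [(p + 1) + (N - 2) + (2 * N - 1) * p + 1]. The
     blocks of length [2 * N - 1] become commutators of [a^-1] with [b]. *)
  have -> : y ^+ (q * N + r) = y ^+ p.+1 * y ^+ (N - 2) * (y ^+ N.*2.-1) ^+ p * y.
    rewrite -expgnA -!expgnDr -expgSr; congr (_ ^+ _).
    rewrite qE r0 eE; lia.
  have E := comm_eq_mul (comm_eq_mul (comm_eq_mul (comm_eq_refl (y ^+ p.+1)) v)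
              (comm_eq_exp p y')) (comm_eq_refl y).
  have uE : a = (a * a ^+ (N - 2))^-1.
    apply/esym/mulg1_eq; rewrite -expgS -expgSr.
    by rewrite (_ : (N - 2).+2 = N) //; lia.
  have C := comm_pow_three b p (commuteX (N - 2) (commute_refl a)) uE.
  apply: prod_commutators_leq (prod_commutators_eq E C).
  rewrite qE r0 eE; have -> : (e.*2.+3.*2.-1./2.-1 = e.*2.+1)%N by lia.
  have -> : ((e.*2.+3 - 2)./2 = e)%N by lia.
  lia.
have r_even : ~~ odd r by move: n_odd; rewrite oddD oddM N_odd q_odd.
have m1_odd : odd (N + r) by lia.
have d_odd : odd d by lia.
have lem : (N < N + r < N.*2)%N by lia.
apply: (split _ _ (N + r)%N d p (comm_pow_odd_torsion b aN N_odd m1_odd lem)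
         (comm_pow_odd a b d_odd)).
- rewrite -addnA -NE; exact/dvdn_add.
- rewrite qE NE; lia.
- have [r' rE] : exists r', r = r'.+1.*2 by exists r.-1./2; lia.
  have [d' dE] : exists d', d = d'.*2.+1 by exists d./2; lia.
  have -> : ((N + r)./2.-1 = r'.*2.+1 + d')%N by lia.
  have -> : (d./2 = d')%N by lia.
  rewrite qE NE rE dE; lia.
Qed.

(** Equally many windows of two lengths are used: [1] and [2 * N - 1] for odd [N], [1] and [N - 1]
    for even [N]. *)
Lemma comm_pow_torsion_dvd a b N q : a ^+ N = 1 -> (1 < N)%N -> ~~ odd (q * N) ->
  prod_commutators ([~ a, b] ^+ (q * N)) ((q * N) %/ 2 - q + 1).
Proof.
move=> aN N_gt1 n_even; have y1 : comm_eq 0 ([~ a, b] ^+ 1) [~ a, b] by apply: comm_eq_refl.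
have [N_odd|N_even] := boolP (odd N).
  have q_even : ~~ odd q by move: n_even; rewrite oddM N_odd andbT.
  have [p qE] : exists p, q = p.*2 by exists q./2; lia.
  have m_odd : odd (N.*2.-1) by lia.
  have lem : (N < N.*2.-1 < N.*2)%N by lia.
  have y' := comm_pow_odd_torsion b aN N_odd m_odd lem.
  have dvd : (N %| 1 + N.*2.-1)%N.
    by rewrite (_ : 1 + N.*2.-1 = 2 * N)%N ?dvdn_mull //; lia.
  rewrite (expg_inv_torsion aN dvd) expg1 in y'.
  have [+ _] := comm_pow_split p y1 y'.
  have [e eE] : exists e, N = e.+2 by exists (N - 2)%N; lia.
  have -> : (1 * p + N.*2.-1 * p = q * N)%N by rewrite qE eE; lia.
  apply: prod_commutators_leq; rewrite qE eE.
  have -> : (e.+2.*2.-1./2.-1 = e)%N by lia.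
  lia.
have m_odd : odd N.-1 by lia.
have y' := comm_pow_odd a b m_odd.
have dvd : (N %| 1 + N.-1)%N by rewrite add1n prednK // ltnW.
rewrite (expg_inv_torsion aN dvd) expg1 in y'.
have [+ _] := comm_pow_split q y1 y'.
have [e eE] : exists e, N = e.+1.*2 by exists N./2.-1; lia.
have -> : (1 * q + N.-1 * q = q * N)%N by rewrite eE; lia.
apply: prod_commutators_leq; rewrite eE.
have -> : (e.+1.*2.-1./2 = e)%N by lia.
lia.
Qed.

Lemma comm_pow_torsion a b n N : a ^+ N = 1 -> (1 < N)%N -> (0 < n)%N ->
  prod_commutators ([~ a, b] ^+ n) (n %/ 2 - n %/ N + 1).
Proof.
move=> aN N_gt1 n_gt0; have N_gt0 := ltnW N_gt1.
pose q := (n %/ N)%N; pose r := (n %% N)%N.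
have nE : n = (q * N + r)%N by apply: divn_eq.
have r_lt : (r < N)%N by rewrite ltn_mod.
rewrite -/q; have [n_odd|n_even] := boolP (odd n).
  by rewrite nE; apply: comm_pow_torsion_odd; rewrite // -nE.
have [r0|r_gt0] := posnP r.
  by rewrite nE r0 addn0; apply: comm_pow_torsion_dvd; rewrite // -[(q * N)%N]addn0 -r0 -nE.
(* As [r > 0], splitting off one factor leaves an odd exponent with the same quotient by [N]. *)
have n1E : n.-1 = (q * N + r.-1)%N by lia.
have -> : (n %/ 2 - q + 1 = n.-1 %/ 2 - q + 1 + 1)%N.
  have : (q * 2 <= q * N)%N by rewrite leq_mul2l N_gt1 orbT.
  lia.
rewrite -(prednK n_gt0) expgSr /=.
apply: prod_commutators_mul (prod_commutators1 _ _).
by rewrite n1E; apply: comm_pow_torsion_odd; rewrite // -?n1E; lia.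
Qed.

End UpperBound.

(** * Orbits of permutations *)

Section CyclePerm.
Variable X : finType.
Implicit Types (p q r : seq X) (x y z : X) (s t : {perm X}).

(** On a list without duplicates, the cycle sending each entry to the next. It is built from
    transpositions so that editing the list multiplies it by transpositions. *)
Fixpoint cycle_perm p : {perm X} :=
  match p with
  | x :: ((y :: _) as q) => cycle_perm q * tperm x y
  | _ => 1
  end.

Lemma cycle_perm_cons x y q :
  cycle_perm [:: x, y & q] = cycle_perm (y :: q) * tperm x y.
Proof. by []. Qed.

Lemma cycle_perm_out p x : x \notin p -> cycle_perm p x = x.
Proof.
elim: p => [|y [|z q] IHq] xp; rewrite ?perm1 // cycle_perm_cons permM.
move: xp; rewrite inE negb_or => /andP[xy xq].
by rewrite IHq // tpermD // eq_sym //; case/norP: xq.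
Qed.

Lemma cycle_perm_commute_tperm p x y :
  x \notin p -> y \notin p -> commute (cycle_perm p) (tperm x y).
Proof.
by move=> xp yp; rewrite /commute [RHS]conjgC tpermJ !cycle_perm_out.
Qed.

Lemma cycle_perm_commute p q :
  uniq (p ++ q) -> commute (cycle_perm p) (cycle_perm q).
Proof.
elim: q => [|y [|z q] IHq]; try by move=> *; apply: commute1.
rewrite uniq_catC cat_cons cons_uniq mem_cat negb_or => /andP[/andP[_ yp] uzq].
apply: commuteM; first by apply: IHq; rewrite uniq_catC.
apply: cycle_perm_commute_tperm => //.
by move: uzq; rewrite cat_cons cons_uniq mem_cat negb_or => /andP[/andP[]].
Qed.

Lemma cycle_perm_cat x p y q : uniq ((x :: p) ++ y :: q) ->
  cycle_perm ((x :: p) ++ y :: q) =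
    cycle_perm (x :: p) * cycle_perm (y :: q) * tperm x y.
Proof.
elim: p x => [|z p IHp] x; first by rewrite /= mul1g.
rewrite cat_cons cons_uniq => /andP[xzpq uzpq].
have [xz xp xy xq] : [/\ x != z, x \notin p, x != y & x \notin q].
  by move: xzpq; rewrite mem_cat !inE !negb_or => /andP[/andP[-> ->] /andP[-> ->]].
have zyq : z \notin y :: q.
  by move: uzpq; rewrite cat_cons cons_uniq mem_cat negb_or => /andP[/andP[]].
have xyq : x \notin y :: q by rewrite inE negb_or xy.
rewrite cat_cons cycle_perm_cons -cat_cons IHp // cycle_perm_cons -!mulgA.
congr (_ * _); rewrite !mulgA -(cycle_perm_commute_tperm xyq zyq) -!mulgA; congr (_ * _).
by rewrite [LHS]conjgC tpermJ tpermR tpermD //; move: zyq; rewrite inE negb_or => /andP[].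
Qed.

Lemma cycle_perm_catC p q : uniq (p ++ q) -> cycle_perm (p ++ q) = cycle_perm (q ++ p).
Proof.
case: p q => [|x p] [|y q] upq; rewrite ?cats0 //.
rewrite !cycle_perm_cat ?(uniq_catC (y :: q)) // tpermC.
by rewrite (cycle_perm_commute upq).
Qed.

(** Exchanging two adjacent blocks takes exactly two transpositions of heads of blocks; this is what
    makes it cost a single handle. *)
Lemma cycle_perm_swap x p y q z r : uniq ((x :: p) ++ (y :: q) ++ z :: r) ->
  cycle_perm ((y :: q) ++ (x :: p) ++ z :: r) =
    cycle_perm ((x :: p) ++ (y :: q) ++ z :: r) * tperm x y * tperm x z.
Proof.
move=> u; have u' := u; rewrite uniq_catCA in u'.
have [uqr upr] : uniq ((y :: q) ++ z :: r) /\ uniq ((x :: p) ++ z :: r).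
  by split; [have : uniq ((x :: p) ++ ((y :: q) ++ z :: r)) by [] |
             have : uniq ((y :: q) ++ ((x :: p) ++ z :: r)) by []];
     rewrite cat_uniq => /and3P[].
have upq : uniq ((x :: p) ++ y :: q) by move: u; rewrite catA cat_uniq => /and3P[].
have [xy xz yz] : [/\ x != y, x != z & y != z].
  move: u uqr; rewrite 2!cat_cons 2!cons_uniq => /andP[xn _] /andP[yn _].
  split; [apply: contraNneq xn|apply: contraNneq xn|apply: contraNneq yn] => ->;
    by rewrite !(mem_cat, inE) eqxx ?orbT.
have yzr : uniq (y :: (q ++ z :: r)) by [].
have xzr : uniq (x :: (p ++ z :: r)) by [].
rewrite [cycle_perm ((y :: q) ++ x :: (p ++ z :: r))]cycle_perm_cat //.
rewrite [cycle_perm ((x :: p) ++ y :: (q ++ z :: r))]cycle_perm_cat //.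
rewrite -!cat_cons !cycle_perm_cat // !mulgA (cycle_perm_commute upq) -!mulgA.
do 3!congr (_ * _).
rewrite (mulgA (tperm x y)) tperm2 mul1g [RHS]conjgC tpermJ tpermR (tpermC y).
by rewrite (tpermC _ x) tpermD // eq_sym.
Qed.

Lemma cycle_perm_nth x0 p i : uniq p -> (i < size p)%N ->
  cycle_perm p (nth x0 p i) = nth x0 p (i.+1 %% size p).
Proof.
elim: p i => [|x [|y q] IHq] // i; first by case: i => // _ _; rewrite perm1.
rewrite cons_uniq => /andP[xq uq]; rewrite cycle_perm_cons permM.
case: i => [_|i lti]; first by rewrite cycle_perm_out // tpermL modn_small.
rewrite -[nth x0 _ i.+1]/(nth x0 (y :: q) i) IHq //.
have [ltq|geq] := ltnP i.+1 (size (y :: q)).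
  rewrite !modn_small // tpermD //.
    by apply: contraNneq xq => ->; apply: mem_nth.
  by rewrite -[X in X != _]/(nth x0 (y :: q) 0) nth_uniq.
have -> : i.+1 = size (y :: q) by apply/eqP; rewrite eqn_leq geq andbT -ltnS.
by rewrite modnn [size (x :: _)]/= modnn /= tpermR.
Qed.

Lemma card_porbits_tperm_leq s x y :
  (#|porbits s| <= #|porbits (tperm x y * s)| + 1)%N.
Proof.
have := porbits_mul_tperm s x y; have [->|xy] := eqVneq x y.
  by rewrite tperm1 mul1g leq_addr.
by case: (_ \notin _) => /=; lia.
Qed.

Lemma card_porbits_tperm_split s x y : x != y -> x \in porbit s y ->
  #|porbits (tperm x y * s)| = (#|porbits s| + 1)%N.
Proof. by move=> xy xsy; have := porbits_mul_tperm s x y; rewrite xy xsy /= addn0. Qed.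

Lemma card_porbits_tperm_merge s x y : s x = x -> x != y ->
  (#|porbits (tperm x y * s)| + 1)%N = #|porbits s|.
Proof.
move=> sx xy; have := porbits_mul_tperm s x y; rewrite xy porbit_sym.
have -> : (y \in porbit s x) = false; last by move=> /=; lia.
apply/negP => /porbitP[i yE]; case/eqP: xy; rewrite yE.
by elim: i {yE} => [|i IHi]; rewrite ?perm1 // expgSr permM -IHi.
Qed.

Lemma porbit_tperm_out s x y z : x \notin porbit s z -> y \notin porbit s z ->
  porbit (tperm x y * s) z = porbit s z.
Proof.
move=> xz yz; have E i : ((tperm x y * s) ^+ i) z = (s ^+ i) z.
  elim: i => [|i IHi]; rewrite ?perm1 // !expgSr !permM IHi tpermD //.
    by apply: contraNneq xz => ->; apply: mem_porbit.
  by apply: contraNneq yz => ->; apply: mem_porbit.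
apply/setP => t; apply/porbitP/porbitP => -[i ->]; exists i; exact/esym/E || exact: E.
Qed.

End CyclePerm.

(** * Adding a fixed point to a permutation *)

Section OptionPerm.
Variable X : finType.
Implicit Types (s t : {perm X}) (p : seq X).

Lemma omap_perm_inj s : injective (omap s).
Proof. by move=> [x|] [y|] //= [] /perm_inj->. Qed.

Definition option_perm s : {perm option X} := perm (@omap_perm_inj s).

Lemma option_permM s t : option_perm (s * t) = option_perm s * option_perm t.
Proof. by apply/permP => -[x|]; rewrite !(permM, permE) /= ?permM. Qed.

Lemma option_permV s : option_perm s^-1 = (option_perm s)^-1.
Proof.
apply/esym/mulg1_eq; rewrite -option_permM mulgV.
by apply/permP => -[x|]; rewrite !permE /= ?perm1.
Qed.

Lemma option_perm_tperm x y : option_perm (tperm x y) = tperm (Some x) (Some y).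
Proof.
apply/permP => -[z|]; rewrite permE /=; last by rewrite tpermD.
by case: tpermP => [->|->|/eqP zx /eqP zy]; rewrite ?tpermL ?tpermR // tpermD // eq_sym.
Qed.

Lemma cycle_perm_map_Some p : cycle_perm (map Some p) = option_perm (cycle_perm p).
Proof.
have E : 1 = option_perm 1 by apply/permP => -[x|]; rewrite !permE //= perm1.
by elim: p => [|x [|y q] IHq] //; rewrite [map _ _]/= !cycle_perm_cons IHq
   option_permM option_perm_tperm.
Qed.

Lemma porbit_option s x : porbit (option_perm s) (Some x) = Some @: porbit s x.
Proof.
have E i : (option_perm s ^+ i) (Some x) = Some ((s ^+ i) x).
  by elim: i => [|i IHi]; rewrite ?perm1 // !expgSr !permM IHi permE.
apply/setP => y; apply/porbitP/imsetP => [[i ->]|[z /porbitP[i ->] ->]].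
  by exists ((s ^+ i) x); rewrite ?mem_porbit ?E.
by exists i; rewrite E.
Qed.

Lemma porbit_fix (Y : finType) (s : {perm Y}) x : s x = x -> porbit s x = [set x].
Proof.
move=> sx; apply/setP => y; rewrite inE; apply/porbitP/eqP => [[i ->]|->]; last first.
  by exists 0%N; rewrite perm1.
by elim: i => [|i IHi]; rewrite ?perm1 // expgSr permM IHi.
Qed.

Lemma porbits_option s :
  porbits (option_perm s) = [set None] |: [set Some @: O | O : {set X} in porbits s].
Proof.
apply/setP => O; rewrite !inE; apply/imsetP/orP => [[[x|] _ ->]|].
- by right; rewrite porbit_option; apply: imset_f; apply: imset_f.
- by left; rewrite porbit_fix // permE.
case=> [/eqP->|/imsetP[_ /imsetP[x _ ->] ->]].
  by exists None; rewrite // porbit_fix // permE.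
by exists (Some x); rewrite // porbit_option.
Qed.

Lemma card_porbits_option s : #|porbits (option_perm s)| = #|porbits s|.+1.
Proof.
rewrite porbits_option cardsU1 card_imset; last exact: imset_inj Some_inj.
rewrite (_ : _ \notin _) //; apply/negP => /imsetP[_ /imsetP[x _ ->]] /setP/(_ None).
by rewrite !inE eqxx => /esym/imsetP[].
Qed.

End OptionPerm.

(** * Orbits with trivial product *)

Section GoodOrbits.
Variables (X : finType) (G : groupType).
Implicit Types (s t : {perm X}) (val h : X -> G).

(* [h] witnesses that the product of [val] along an orbit is trivial. *)
Definition good_orbits val s h : {set {set X}} :=
  [set O in porbits s | [forall x in O, h (s x) == h x * val x]].

Lemma good_orbitsP val s h O :
  reflect (exists2 x, O = porbit s x & forall y, y \in porbit s x -> h (s y) = h y * val y)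
          (O \in good_orbits val s h).
Proof.
rewrite inE; apply: (iffP andP) => [[/imsetP[x _ ->] /forall_inP gx]|[x -> gx]].
  by exists x => // y /gx/eqP.
by split; [apply: imset_f | apply/forall_inP => y /gx->].
Qed.

Lemma porbit_step s x y : y \in porbit s x -> s y \in porbit s x.
Proof. by move=> /porbitP[i ->]; apply/porbitP; exists i.+1; rewrite expgSr permM. Qed.

Lemma good_orbits_tperm_out val s h h' x y O :
  O \in good_orbits val s h -> x \notin O -> y \notin O -> {in O, h =1 h'} ->
  O \in good_orbits val (tperm x y * s) h'.
Proof.
move=> /good_orbitsP[z -> gz] xz yz hh'; apply/good_orbitsP; exists z.
  by rewrite porbit_tperm_out.
move=> t; rewrite porbit_tperm_out // => tz.
rewrite permM tpermD; last 2 first.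
- by apply: contraNneq xz => ->.
- by apply: contraNneq yz => ->.
by rewrite -!hh' ?gz // porbit_step.
Qed.

Lemma porbit_notin s x O : O \in porbits s -> O != porbit s x -> x \notin O.
Proof.
move=> /imsetP[z _ ->]; apply: contra => xz.
by rewrite eq_sym eq_porbit_mem.
Qed.

Lemma good_porbits val s h O : O \in good_orbits val s h -> O \in porbits s.
Proof. by rewrite inE => /andP[]. Qed.

(** If [x] and [y] lie in two different good orbits, these merge into one, which is good once [h] is
    translated on one of them. Otherwise at most one good orbit is affected. *)
Lemma card_good_orbits_tperm val s h x y : exists h',
  (#|good_orbits val s h| <= #|good_orbits val (tperm x y * s) h'| + 1)%N.
Proof.
set A := good_orbits val s h; pose Ox := porbit s x; pose Oy := porbit s y.
have out h' : {in ~: (Ox :|: Oy), h =1 h'} ->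
    A :\ Ox :\ Oy \subset good_orbits val (tperm x y * s) h'.
  move=> hh'; apply/subsetP => O; rewrite 2!in_setD1 => /and3P[OnY OnX OA].
  have sO := good_porbits OA.
  apply: good_orbits_tperm_out OA (porbit_notin sO OnX) (porbit_notin sO OnY) _.
  have OE z : z \in O -> O = porbit s z.
    by case/imsetP: sO => t _ -> zt; apply/esym/eqP; rewrite eq_porbit_mem.
  move=> z /OE O_z; apply: hh'; rewrite in_setC in_setU -!eq_porbit_mem -O_z.
  by rewrite negb_or OnX.
have [xy|xny] := eqVneq Ox Oy.
  exists h; have /(_ (fun _ _ => erefl))/subset_leq_card := out h.
  rewrite (cardsD1 Ox A) -xy; have -> : A :\ Ox :\ Ox = A :\ Ox.
    by apply/setP => O; rewrite !inE; case: eqP.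
  by move: #|_| #|_| (Ox \in A) => m n [] ?; lia.
have [XA|XnA] := boolP (Ox \in A); last first.
  exists h; have /(_ (fun _ _ => erefl))/subset_leq_card := out h.
  rewrite (cardsD1 Ox A) (negbTE XnA) (cardsD1 Oy (A :\ Ox)).
  by move: #|_| #|_| (Oy \in _) => m n [] ?; lia.
have [YA|YnA] := boolP (Oy \in A); last first.
  exists h; have /(_ (fun _ _ => erefl))/subset_leq_card := out h.
  rewrite (cardsD1 Ox A) XA (cardsD1 Oy (A :\ Ox)) in_setD1 (negbTE YnA) andbF.
  by move: #|_| #|_| => m n ?; lia.
(* The new permutation sends [x] to [s y], so the new witness must take at [s y] the value of [h] at
   [s x]. *)
pose c := h (s x) * (h (s y))^-1.
pose h' z := if z \in Oy then c * h z else h z.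
have gX z : z \in Ox -> h (s z) = h z * val z.
  case/good_orbitsP: XA => t; rewrite /Ox => -> gt zt; exact: gt.
have gY z : z \in Oy -> h (s z) = h z * val z.
  case/good_orbitsP: YA => t; rewrite /Oy => -> gt zt; exact: gt.
have XY z : z \in Ox -> z \in Oy = false.
  move=> zx; apply: contraNF xny => zy; rewrite -[Ox](_ : porbit s z = _) /Oy.
    by rewrite eq_porbit_mem.
  by apply/eqP; rewrite eq_porbit_mem.
have [xX yY] : x \in Ox /\ y \in Oy by split; apply: porbit_id.
exists h'; pose O' := porbit (tperm x y * s) x.
have gXY z : z \in Ox :|: Oy -> (tperm x y * s) z \in Ox :|: Oy /\
    h' ((tperm x y * s) z) = h' z * val z.
  rewrite permM; case: tpermP => [->|->|/eqP zx /eqP zy] zXY.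
  - split; first by rewrite inE [_ \in Oy]porbit_step ?orbT.
    by rewrite /h' [_ \in Oy]porbit_step // XY // -gX // /c mulgVK.
  - split; first by rewrite inE [_ \in Ox]porbit_step.
    rewrite /h' XY; last exact: porbit_step.
    by rewrite yY -mulgA -gY // /c mulgVK.
  - case/setUP: zXY => [zX|zY].
      by split; rewrite ?inE ?[_ \in Ox]porbit_step // /h' !XY ?gX // porbit_step.
    split; first by rewrite inE [_ \in Oy]porbit_step ?orbT.
    by rewrite /h' zY [_ \in Oy]porbit_step // gY // mulgA.
have O'sub z : z \in O' -> z \in Ox :|: Oy.
  case/porbitP => i ->; elim: i => [|i IHi]; first by rewrite perm1 inE xX.
  by rewrite expgSr permM; case: (gXY _ IHi).
have sub : O' |: (A :\ Ox :\ Oy) \subset good_orbits val (tperm x y * s) h'.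
  rewrite subUset out ?andbT; last first.
    by move=> z; rewrite !inE /h' => /norP[_ /negbTE->].
  rewrite sub1set; apply/good_orbitsP; exists x => // z /O'sub/gXY[] //.
have := subset_leq_card sub; rewrite cardsU1.
have -> : O' \notin A :\ Ox :\ Oy.
  apply/negP; rewrite 2!in_setD1 => /and3P[_ /eqP nX /good_porbits/imsetP[t _ O'E]].
  by case: nX; rewrite O'E; apply/esym/eqP; rewrite eq_porbit_mem -O'E porbit_id.
rewrite (cardsD1 Ox A) XA (cardsD1 Oy (A :\ Ox)) in_setD1 eq_sym xny YA /=.
by move: #|_| #|_| => m n ?; lia.
Qed.

(** The point [y] becomes a good orbit by itself. If its old orbit was good, what is left of it
    stays good because [val y = 1]. *)
Lemma card_good_orbits_isolate val s h y : val y = 1 -> s y != y ->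
  (#|good_orbits val s h| + 1 <= #|good_orbits val (tperm y (s^-1 y) * s) h|)%N.
Proof.
move=> vy sy; set z := s^-1 y; set t := _ * s; set A := good_orbits val s h.
have sz : s z = y by rewrite permKV.
have zy : z != y by apply: contraNneq sy => zy; rewrite -{1}zy sz.
have ty : t y = y by rewrite permM tpermL.
have tz : t z = s y by rewrite permM tpermR.
have tout x : x != y -> x != z -> t x = s x.
  by move=> xy xz; rewrite permM tpermD // eq_sym.
pose Oy := porbit s y.
have zO : z \in Oy by rewrite porbit_sym; apply/porbitP; exists 1%N; rewrite expg1 sz.
have zE : porbit s z = Oy by apply/eqP; rewrite eq_porbit_mem.
have out : A :\ Oy \subset good_orbits val t h.
  apply/subsetP => O; rewrite in_setD1 => /andP[OnY OA].
  have sO := good_porbits OA.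
  apply: good_orbits_tperm_out OA (porbit_notin sO OnY) (porbit_notin sO _) _ => //.
  by rewrite zE.
have y_good : [set y] \in good_orbits val t h.
  apply/good_orbitsP; exists y; rewrite porbit_fix // => x; rewrite inE => /eqP->.
  by rewrite ty vy mulg1.
have yn : [set y] \notin A :\ Oy.
  rewrite in_setD1; apply/negP => /andP[nY /good_porbits sY].
  by have := porbit_notin sY nY; rewrite inE eqxx.
have [YA|YnA] := boolP (Oy \in A); last first.
  have : [set y] |: A :\ Oy \subset good_orbits val t h by rewrite subUset sub1set y_good.
  move/subset_leq_card; rewrite cardsU1 yn (cardsD1 Oy A) (negbTE YnA).
  by move: #|_| #|_| => m n ?; lia.
have gY x : x \in Oy -> h (s x) = h x * val x.
  case/good_orbitsP: YA => u; rewrite /Oy => -> gt zt; exact: gt.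
pose Oz := porbit t z.
have Ozsub x : x \in Oz -> x \in Oy /\ x != y.
  case/porbitP => i ->; elim: i => [|i [IH1 IH2]]; first by rewrite perm1.
  rewrite expgSr permM; split; last first.
    by apply: contra IH2 => /eqP; rewrite -{1}ty => /perm_inj->.
  have [->|nz] := eqVneq ((t ^+ i) z) z; first by rewrite tz porbit_step ?porbit_id.
  by rewrite tout // porbit_step.
have z_good : Oz \in good_orbits val t h.
  apply/good_orbitsP; exists z => // x /Ozsub[xY xy].
  have [->|nz] := eqVneq x z; last by rewrite tout // gY.
  by rewrite tz -gY // sz gY ?porbit_id // vy mulg1.
have zn : Oz \notin [set y] |: A :\ Oy.
  rewrite !inE !negb_or; apply/andP; split.
    apply/eqP => /setP/(_ y); rewrite [RHS]inE eqxx => /Ozsub[_].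
    by rewrite eqxx.
  apply/negP => /and3P[nY sY _]; rewrite -zE in nY.
  by have := porbit_notin sY nY; rewrite porbit_id.
have : Oz |: ([set y] |: A :\ Oy) \subset good_orbits val t h.
  by rewrite !subUset !sub1set z_good y_good.
move/subset_leq_card; rewrite !cardsU1 zn yn (cardsD1 Oy A) YA.
by move: #|_| #|_| => m n ?; lia.
Qed.

(** The product along an orbit only sees the product of the two consecutive values; [h] has to
    change at [y] alone. *)
Lemma card_good_orbits_relabel val val' s h x y : x != y -> s x = y ->
  val x * val y = val' x * val' y ->
  (forall z, z != x -> z != y -> val z = val' z) ->
  exists h', (#|good_orbits val s h| <= #|good_orbits val' s h'|)%N.
Proof.
move=> xy sx vxy vout; pose h' z := if z == y then h x * val' x else h z.
exists h'; apply/subset_leq_card/subsetP => O /good_orbitsP[u -> gu].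
apply/good_orbitsP; exists u => // z zu.
have [zx|zx] := eqVneq z x.
  by rewrite zx sx /h' eqxx (negbTE xy).
have sz : s z != y by rewrite -sx; apply: contraNneq zx => /perm_inj->.
rewrite /h' (negbTE sz); have [zy|zy] := eqVneq z y; last by rewrite gu // vout.
have xu : x \in porbit s u.
  by rewrite -eq_porbit_mem -(porbit_perm s 1 x) expg1 sx -zy eq_porbit_mem.
have hy : h y = h x * val x by rewrite -sx gu.
by rewrite gu // zy hy -!mulgA vxy.
Qed.

End GoodOrbits.

(** * Surfaces bounded by words *)

Lemma card_good_orbits_option (X : finType) (G : groupType) (val h : X -> G) c s :
  (#|good_orbits val s h| + 1 <=
   #|good_orbits (oapp val 1%g) (option_perm s) (oapp h c)|)%N.
Proof.
have <- : #|[set None] |: [set Some @: O | O : {set X} in good_orbits val s h]|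
    = (#|good_orbits val s h| + 1)%N.
  rewrite cardsU1 card_imset; last exact: imset_inj Some_inj.
  rewrite (_ : _ \notin _); first by rewrite addnC.
  apply/negP => /imsetP[O _] /setP/(_ None).
  by rewrite inE eqxx => /esym/imsetP[].
apply/subset_leq_card; rewrite subUset sub1set; apply/andP; split.
  have N : option_perm s None = None by rewrite permE.
  apply/good_orbitsP; exists None; rewrite porbit_fix // => x; rewrite inE => /eqP->.
  by rewrite N /= mulg1.
apply/subsetP => _ /imsetP[_ /good_orbitsP[x -> gx] ->].
apply/good_orbitsP; exists (Some x); rewrite porbit_option // => _ /imsetP[y yx ->].
by rewrite permE /= gx.
Qed.

Section Surfaces.
Variables (J : Type) (A : J -> groupType) (G : groupType) (iota : forall j, A j -> G).
Hypothesis iotaM : forall j, monoid_morphism (@iota j).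

Local Notation letter := {j : J & A j}.
Implicit Types (u v w : seq letter) (k : nat).

Definition letter_val (x : letter) : G := @iota (tag x) (tagged x).

(** In a surface, each point outside [p] is one disc and one central orbit, which offsets its share
    of [2 * #|X|]. For nonempty [p], what remains is that discs plus central orbits minus [size p]
    is at least [1 - 2 * k]. *)
Definition euler_count (X : finType) (p : seq X) (s : {perm X}) (D : nat) : nat :=
  (D + #|porbits ((cycle_perm p)^-1 * s)| + size p + (size p == 0))%N.

(* A surface with one boundary component read along [p]: its pieces are the orbits of [s]
   (those in [good_orbits] are discs, the others contribute nothing) and those of
   [(cycle_perm p)^-1 * s]. The inequality says that its Euler characteristic is at least
   [1 - 2 * k]. Points outside [p] are fixed by both permutations and make it possible to
   add and delete letters on the same [X]; the empty [p] bounds a disc. *)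
Definition surface (X : finType) (lab : X -> letter) (p : seq X) (s : {perm X})
    (h : X -> G) k :=
  [/\ uniq p,
      forall x, x \notin p -> s x = x /\ letter_val (lab x) = 1,
      forall x, tag (lab (s x)) = tag (lab x) &
      (2 * #|X| + 1 <= 2 * k + euler_count p s #|good_orbits (letter_val \o lab) s h|)%N].

(* The word [w] is read along the boundary of a surface of genus at most [k]. *)
Definition bounds k w :=
  exists (X : finType) (lab : X -> letter) p s h,
    map lab p = w /\ surface lab p s h k.

Lemma bounds_nil k : bounds k [::].
Proof.
exists void, (of_void _), [::], 1, (of_void _); split=> //.
split=> [|[]|[]|] //; rewrite /euler_count card_void /=; lia.
Qed.

Lemma bounds_leq k l w : (k <= l)%N -> bounds k w -> bounds l w.
Proof.
move=> kl [X [lab [p [s [h [wE [up dead tags genus]]]]]]].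
exists X, lab, p, s, h; split=> //; split=> //; lia.
Qed.

Lemma bounds_rot k u v : bounds k (u ++ v) -> bounds k (v ++ u).
Proof.
move=> [X [lab [p [s [h [wE [up dead tags genus]]]]]]].
pose p1 := take (size u) p; pose p2 := drop (size u) p.
have pE : p = p1 ++ p2 by rewrite cat_take_drop.
exists X, lab, (p2 ++ p1), s, h; split.
  by rewrite map_cat map_take map_drop wE take_size_cat // drop_size_cat.
split=> //; first by rewrite uniq_catC -pE.
  by move=> x; rewrite mem_cat orbC -mem_cat -pE; apply: dead.
have sz : size (p2 ++ p1) = size p by rewrite pE !size_cat addnC.
by rewrite /euler_count sz -cycle_perm_catC -?pE.
Qed.

Lemma invg_mul_tperm (X : finType) (c s : {perm X}) a b :
  (c^-1 * (tperm a b * s)) = tperm (c a) (c b) * (c^-1 * s).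
Proof. by rewrite -tpermJ conjgE !mulgA mulgK. Qed.

(** The central permutation is multiplied by two transpositions, so it loses at most two orbits,
    which one more handle pays for. If a block is empty, the new word is the old one or a rotation
    of it. *)
Lemma bounds_swap k u v w : bounds k (u ++ v ++ w) -> bounds k.+1 (v ++ u ++ w).
Proof.
move=> H; have /bounds_leq := H => /(_ k.+1 (leqnSn k)).
case: u H => [|a u] //; case: v => [|b v] //; case: w => [|c w] H.
  by rewrite !cats0 => /bounds_rot.
move=> _; case: H => X [lab [p [s [h [wE [up dead tags genus]]]]]].
pose p1 := take (size (a :: u)) p; pose q := drop (size (a :: u)) p.
pose p2 := take (size (b :: v)) q; pose p3 := drop (size (b :: v)) q.
have qE : q = p2 ++ p3 by rewrite cat_take_drop.
have pE : p = p1 ++ p2 ++ p3 by rewrite -qE cat_take_drop.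
have m1 : map lab p1 = a :: u by rewrite map_take wE take_size_cat.
have mq : map lab q = (b :: v) ++ c :: w by rewrite map_drop wE drop_size_cat.
have m2 : map lab p2 = b :: v by rewrite map_take mq take_size_cat.
have m3 : map lab p3 = c :: w by rewrite map_drop mq drop_size_cat.
exists X, lab, (p2 ++ p1 ++ p3), s, h; split; first by rewrite !map_cat m1 m2 m3.
move: (p1) (p2) (p3) m1 m2 m3 pE => [|x q1] [|y q2] [|z q3] // _ _ _ pE.
split=> //; first by rewrite uniq_catCA -pE.
  by move=> t; rewrite mem_cat orbC -mem_cat -catA => tn; apply: dead; move: tn;
     rewrite pE !mem_cat !negb_or => /and3P[-> -> ->].
have up' : uniq ((x :: q1) ++ (y :: q2) ++ z :: q3) by rewrite -pE.
move: genus; rewrite /euler_count (cycle_perm_swap up') -pE.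
have -> : size ((y :: q2) ++ (x :: q1) ++ z :: q3) = size p.
  by rewrite pE !size_cat addnCA.
rewrite !invgM !tpermV -!mulgA.
set r := (cycle_perm p)^-1 * s.
have := card_porbits_tperm_leq r x y; have := card_porbits_tperm_leq (tperm x y * r) x z.
move: #|_| #|_| #|_| #|X| #|_| => ? ? ? ? ?; lia.
Qed.

Lemma letter_val1 j : letter_val (existT A j 1) = 1.
Proof. by rewrite /letter_val /=; case: (iotaM j). Qed.

Lemma letter_valM j (a b : A j) :
  letter_val (existT A j (a * b)) = letter_val (existT A j a) * letter_val (existT A j b).
Proof. by rewrite /letter_val /=; case: (iotaM j) => _ ->. Qed.

(** The new letter is a fixed point of [s], hence a disc, and joins an existing central orbit; the
    disc and the longer boundary balance the extra point. On an empty boundary it forms a central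
    orbit of its own, and the term for empty [p] disappears. *)
Lemma bounds_insert_head k j v : bounds k v -> bounds k (existT A j 1 :: v).
Proof.
move=> [X [lab [p [s [h [wE [up dead tags genus]]]]]]].
pose lab' := oapp lab (existT A j 1).
have valE : letter_val \o lab' =1 oapp (letter_val \o lab) 1.
  by move=> [x|] //=; rewrite letter_val1.
exists (option X), lab', (None :: map Some p), (option_perm s), (oapp h 1).
split; first by rewrite /= -map_comp -wE; congr (_ :: _); apply: eq_map.
split.
- rewrite /= map_inj_uniq ?up ?andbT; last exact: Some_inj.
  by apply/negP => /mapP[].
- move=> [x|]; rewrite inE //= mem_map; last exact: Some_inj.
  by rewrite permE /= => /dead[-> ->].
- by move=> [x|]; rewrite permE //= tags.
have gE : good_orbits (letter_val \o lab') (option_perm s) (oapp h 1)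
    = good_orbits (oapp (letter_val \o lab) 1) (option_perm s) (oapp h 1).
  by apply/setP => O; rewrite !inE; congr (_ && _); apply: eq_forallb => x; rewrite valE.
rewrite gE card_option /euler_count [size _]/= size_map.
have := card_good_orbits_option (letter_val \o lab) h 1 s.
move: genus; rewrite /euler_count; case: p up dead wE => [|x q] up dead wE.
  rewrite /= !invg1 !mul1g card_porbits_option.
  move: #|_| #|_| #|_| #|_| => ? ? ? ?; lia.
rewrite [map _ _]/= cycle_perm_cons -/(map Some (x :: q)) cycle_perm_map_Some.
rewrite invgM tpermV -mulgA -option_permV -option_permM.
have fixN : option_perm ((cycle_perm (x :: q))^-1 * s) None = None by rewrite permE.
have := card_porbits_tperm_merge fixN (_ : None != Some x).
rewrite card_porbits_option => /(_ isT).
move: #|_| #|_| #|_| #|_| #|_| => ? ? ? ? ?; rewrite /=; lia.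
Qed.

Lemma tags_tperm (X : finType) (lab : X -> letter) (s : {perm X}) x y :
  (forall z, tag (lab (s z)) = tag (lab z)) -> tag (lab x) = tag (lab y) ->
  forall z, tag (lab ((tperm x y * s) z)) = tag (lab z).
Proof. by move=> tags xy z; rewrite permM tags; case: tpermP => [->|->|]. Qed.

Lemma bounds_delete_head k j v : bounds k (existT A j 1 :: v) -> bounds k v.
Proof.
move=> [X [lab [[|y p] [s [h [// [laby wE] [up dead tags genus]]]]]]].
(* First the letter is isolated: one disc is gained and at most one central orbit lost. Afterwards
   it leaves the boundary but stays in [X] as a point fixed by both permutations. *)
have [s1 [s1y dead1 tags1 genus1]] : exists s1 : {perm X},
    [/\ s1 y = y, forall x, x \notin y :: p -> s1 x = x /\ letter_val (lab x) = 1,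
        forall x, tag (lab (s1 x)) = tag (lab x) &
        (2 * #|X| + 1 <= 2 * k +
           euler_count (y :: p) s1 #|good_orbits (letter_val \o lab) s1 h|)%N].
  have [sy|sy] := eqVneq (s y) y; first by exists s.
  have tagz : tag (lab y) = tag (lab (s^-1 y)) by rewrite -[in LHS](permKV s y) tags.
  exists (tperm y (s^-1 y) * s); split.
  - by rewrite permM tpermL permKV.
  - move=> x xn; have [sx vx] := dead x xn; split=> //.
    have [yx zx] : y != x /\ s^-1 y != x.
      have yx : y != x by move: xn; rewrite inE negb_or eq_sym => /andP[].
      by split=> //; apply: contraNneq yx => yx; rewrite -(permKV s y) yx sx.
    by rewrite permM tpermD.
  - exact: tags_tperm.
  have vy : (letter_val \o lab) y = 1 by rewrite /= laby letter_val1.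
  have := card_good_orbits_isolate h vy sy.
  move: genus; rewrite /euler_count invg_mul_tperm.
  have := card_porbits_tperm_leq ((cycle_perm (y :: p))^-1 * s)
            (cycle_perm (y :: p) y) (cycle_perm (y :: p) (s^-1 y)).
  by move: #|_| #|_| #|_| #|_| #|_| => ? ? ? ? ?; lia.
exists X, lab, p, s1, h; split=> //; split=> //.
- by case/andP: up.
- move=> x xp; have [->|xy] := eqVneq x y; first by rewrite s1y laby letter_val1.
  by apply: dead1; rewrite inE negb_or xy.
move: genus1; rewrite /euler_count; case: p up {dead dead1 wE genus} => [|x q] up.
  by rewrite /=; move: #|_| #|_| #|_| => ? ? ?; lia.
rewrite cycle_perm_cons invgM tpermV -mulgA.
have yn : y \notin x :: q by case/andP: up.
have yx : y != x by move: yn; rewrite inE negb_or => /andP[].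
have fixy : ((cycle_perm (x :: q))^-1 * s1) y = y.
  by rewrite permM -{1}(cycle_perm_out yn) permK s1y.
have := card_porbits_tperm_merge fixy yx.
by rewrite /=; move: #|_| #|_| #|_| #|_| => ? ? ? ?; lia.
Qed.

Lemma bounds_relabel_head k j (a b a' b' : A j) v : a * b = a' * b' ->
  bounds k [:: existT A j a, existT A j b & v] ->
  bounds k [:: existT A j a', existT A j b' & v].
Proof.
move=> abE [X [lab [[|x [|y p]] [s [h [// [labx laby wE] [up dead tags genus]]]]]]].
have [xn yn] : x \notin y :: p /\ y \notin p by case/and3P: up.
have xy : x != y by move: xn; rewrite inE negb_or => /andP[].
set q := [:: x, y & p] in up dead genus *.
have cx : cycle_perm q x = y by rewrite cycle_perm_cons permM cycle_perm_out // tpermL.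
(* The two letters are made consecutive in one piece. This may lose a disc, but [y] splits off from
   its central orbit, so the Euler characteristic does not drop. *)
have [s1 [h1 [s1x dead1 tags1 genus1]]] : exists (s1 : {perm X}) (h1 : X -> G),
    [/\ s1 x = y, forall z, z \notin q -> s1 z = z /\ letter_val (lab z) = 1,
        forall z, tag (lab (s1 z)) = tag (lab z) &
        (2 * #|X| + 1 <= 2 * k +
           euler_count q s1 #|good_orbits (letter_val \o lab) s1 h1|)%N].
  have [sx|sx] := eqVneq (s x) y; first by exists s, h.
  set z := s^-1 y; have sz : s z = y by rewrite permKV.
  have xz : x != z by apply: contraNneq sx => ->; rewrite sz.
  have tagz : tag (lab x) = tag (lab z) by rewrite -(tags z) sz labx laby.
  have [h1 le1] := card_good_orbits_tperm (letter_val \o lab) s h x z.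
  exists (tperm x z * s), h1; split.
  - by rewrite permM tpermL.
  - move=> t tn; have [st vt] := dead t tn; split=> //.
    have [tx ty] : x != t /\ y != t.
      by move: tn; rewrite !inE !negb_or !(eq_sym t) => /and3P[-> ->].
    by rewrite permM tpermD //; apply: contraNneq ty => zt; rewrite -sz zt st.
  - exact: tags_tperm.
  move: genus; rewrite /euler_count invg_mul_tperm cx card_porbits_tperm_split.
  - by move: le1; move: #|_| #|_| #|_| #|_| => ? ? ? ?; lia.
  - by rewrite -cx (inj_eq perm_inj).
  apply/porbitP; exists 1%N; by rewrite expg1 permM permK sz.
pose lab' t := if t == x then existT A j a' else if t == y then existT A j b' else lab t.
have lab'x : lab' x = existT A j a' by rewrite /lab' eqxx.
have lab'y : lab' y = existT A j b' by rewrite /lab' eqxx eq_sym (negbTE xy).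
have lab'out t : t != x -> t != y -> lab' t = lab t.
  by move=> tx ty; rewrite /lab' (negbTE tx) (negbTE ty).
have tagE t : tag (lab' t) = tag (lab t).
  by rewrite /lab'; case: eqP => [->|_]; [rewrite labx | case: eqP => [->|//]; rewrite laby].
have [h2 le2] : exists h2, (#|good_orbits (letter_val \o lab) s1 h1| <=
    #|good_orbits (letter_val \o lab') s1 h2|)%N.
  apply: card_good_orbits_relabel xy s1x _ _.
    by rewrite /= labx laby lab'x lab'y -!letter_valM abE.
  by move=> t tx ty; rewrite /= lab'out.
exists X, lab', q, s1, h2; split.
  rewrite /= lab'x lab'y -wE; congr [:: _, _ & _]; apply/eq_in_map => t tp.
  apply: lab'out; first by apply: contraNneq xn => <-; rewrite inE tp orbT.
  by apply: contraNneq yn => <-.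
split=> // [t tn|t|].
- have [tx ty] : t != x /\ t != y by move: tn; rewrite !inE !negb_or => /and3P[-> ->].
  by rewrite lab'out //; apply: dead1.
- by rewrite !tagE.
move: genus1 le2; rewrite /euler_count; move: #|_| #|_| #|_| #|_| => ? ? ? ?; lia.
Qed.

Lemma bounds_insert k u j v : bounds k (u ++ existT A j 1 :: v) <-> bounds k (u ++ v).
Proof.
split=> /bounds_rot H; apply: bounds_rot.
  exact: bounds_delete_head H.
exact: bounds_insert_head H.
Qed.

Lemma bounds_relabel k u j (a b a' b' : A j) v : a * b = a' * b' ->
  bounds k (u ++ [:: existT A j a, existT A j b & v]) ->
  bounds k (u ++ [:: existT A j a', existT A j b' & v]).
Proof.
move=> abE /bounds_rot H; apply: bounds_rot.
exact: bounds_relabel_head abE H.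
Qed.

Lemma bounds_merge k u j (a b : A j) v :
  bounds k (u ++ [:: existT A j a, existT A j b & v]) <->
  bounds k (u ++ existT A j (a * b) :: v).
Proof.
have := bounds_insert k (rcons u (existT A j (a * b))) j v; rewrite !cat_rcons => I.
have E : a * b = a * b * 1 by rewrite mulg1.
by split=> [/(bounds_relabel E)/I|/I/(bounds_relabel (esym E))].
Qed.

End Surfaces.

(** * Words in a free product *)

Section WordQuotient.
Variables (J : Type) (A : J -> groupType).
Local Notation letter := {j : J & A j}.
Implicit Types (u v w : seq letter).

Record word_congruence (R : seq letter -> seq letter -> Prop) : Prop := {
  word_congr_refl : forall w, R w w;
  word_congr_sym : forall w w', R w w' -> R w' w;
  word_congr_trans : forall u v w, R u v -> R v w -> R u w;
  word_congr_cat : forall u u' v v', R u u' -> R v v' -> R (u ++ v) (u' ++ v');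
  word_congr1 : forall j, R [:: existT A j 1] [::];
  word_congrM : forall j (a b : A j),
    R [:: existT A j a; existT A j b] [:: existT A j (a * b)] }.

Definition inv_word w := rev [seq existT A (tag x) (tagged x)^-1 | x <- w].

Lemma inv_word_cons x w :
  inv_word (x :: w) = inv_word w ++ [:: existT A (tag x) (tagged x)^-1].
Proof. by rewrite /inv_word /= rev_cons cats1. Qed.

Section Congruence.
Variables (R : seq letter -> seq letter -> Prop) (congR : word_congruence R).

Lemma word_congr_letterV x : R [:: existT A (tag x) (tagged x)^-1; x] [::].
Proof.
case: x => j a /=; apply: (word_congr_trans congR) (word_congrM congR _ _) _.
by rewrite mulVg; apply: word_congr1.
Qed.

Lemma word_congr_letterVr x : R [:: x; existT A (tag x) (tagged x)^-1] [::].
Proof.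
case: x => j a /=; apply: (word_congr_trans congR) (word_congrM congR _ _) _.
by rewrite mulgV; apply: word_congr1.
Qed.

Lemma word_congr_mulVw w : R (inv_word w ++ w) [::].
Proof.
elim: w => [|x w IHw]; first exact: word_congr_refl congR _.
rewrite inv_word_cons -catA; apply: (word_congr_trans congR) IHw.
apply: (word_congr_cat congR); first exact: word_congr_refl congR _.
rewrite -[X in R _ X]cat0s (_ : _ ++ _ = [:: existT A (tag x) (tagged x)^-1; x] ++ w) //.
by apply: (word_congr_cat congR); [apply: word_congr_letterV | apply: word_congr_refl congR _].
Qed.

Lemma word_congr_mulwV w : R (w ++ inv_word w) [::].
Proof.
elim: w => [|x w IHw]; first exact: word_congr_refl congR _.
apply: (word_congr_trans congR) (word_congr_letterVr x).
rewrite inv_word_cons catA -[X in R _ X]/([:: x] ++ [::] ++ [:: existT A (tag x) (tagged x)^-1]).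
rewrite -[x :: w]/([:: x] ++ w) -!catA (catA w).
do 2!(apply: (word_congr_cat congR); first by [exact: word_congr_refl congR _ | exact: IHw]).
exact: word_congr_refl congR _.
Qed.

Let word := {classic (seq letter)}.
Let congrb (u v : word) := `[< R u v >].

Lemma congrb_refl : reflexive congrb.
Proof. by move=> u; apply/asboolP/(word_congr_refl congR). Qed.

Lemma congrb_sym : symmetric congrb.
Proof. by move=> u v; apply/asboolP/asboolP; apply: (word_congr_sym congR). Qed.

Lemma congrb_trans : transitive congrb.
Proof. by move=> v u w /asboolP uv /asboolP vw; apply/asboolP/(word_congr_trans congR uv). Qed.

Let congr_equiv : equiv_rel word := EquivRel congrb congrb_refl congrb_sym congrb_trans.
Let Q := {eq_quot congr_equiv}.
Let cls (w : seq letter) : Q := \pi_Q (w : word).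

Let clsP w w' : cls w = cls w' <-> R w w'.
Proof.
rewrite /cls; split=> [/eqquotP/asboolP //|Rw].
exact/eqquotP/asboolP.
Qed.

Let cls_repr (q : Q) : cls (repr q) = q.
Proof. exact: reprK. Qed.

Let mulq (x y : Q) : Q := cls (repr x ++ repr y).
Let invq (x : Q) : Q := cls (inv_word (repr x)).

Let cls_cat u v : cls (u ++ v) = mulq (cls u) (cls v).
Proof. by apply/clsP/(word_congr_cat congR); apply/clsP; rewrite cls_repr. Qed.

Let mulqA : associative mulq.
Proof.
by move=> x y z; rewrite -[x]cls_repr -[y]cls_repr -[z]cls_repr -!cls_cat catA.
Qed.

Let mul1q : left_id (cls [::]) mulq.
Proof. by move=> x; rewrite -[x]cls_repr -cls_cat. Qed.

Let mulq1 : right_id (cls [::]) mulq.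
Proof. by move=> x; rewrite -[x]cls_repr -cls_cat cats0. Qed.

Let mulVq : left_inverse (cls [::]) invq mulq.
Proof. by move=> x; rewrite -{2}[x]cls_repr -cls_cat; apply/clsP/word_congr_mulVw. Qed.

Let mulqV : right_inverse (cls [::]) invq mulq.
Proof. by move=> x; rewrite -{1}[x]cls_repr -cls_cat; apply/clsP/word_congr_mulwV. Qed.

Lemma word_quotient : exists (H : groupType) (c : seq letter -> H) (r : H -> seq letter),
  [/\ forall w w', c w = c w' <-> R w w', forall q, c (r q) = q &
      forall u v, c (u ++ v) = c u * c v].
Proof.
pose H : groupType := HB.pack {eq_quot congr_equiv}
  (isGroup.Build {eq_quot congr_equiv} mulqA mul1q mulq1 mulVq mulqV).
by exists H, cls, repr; split.
Qed.

End Congruence.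
End WordQuotient.

Section FreeProductWords.
Variables (J : Type) (A : J -> groupType) (G : groupType) (iota : forall j, A j -> G).
Hypothesis fp : is_free_product iota.
Local Notation letter := {j : J & A j}.
Implicit Types (u v w : seq letter).

Lemma eval_word_cat u v : eval_word iota (u ++ v) = eval_word iota u * eval_word iota v.
Proof. by elim: u => [|x u IHu] /=; rewrite ?mul1g // IHu mulgA. Qed.

(** The quotient of words by [R] is a group receiving morphisms from all factors. The universal
    property maps [G] to it, sending the value of a word to its class. *)
Lemma eval_word_congr R : word_congruence R ->
  forall w w', eval_word iota w = eval_word iota w' -> R w w'.
Proof.
move=> congR w w' ww'; have [H [c [_ [cP _ cM]]]] := word_quotient congR.
have c1 : c [::] = 1.
  by apply: (mulgI (c [::])); rewrite -cM mulg1.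
case: fp => _ /(_ H (fun j a => c [:: existT A j a])) [j|phi [[[phi1 phiM] phiE] _]].
  split; first by rewrite -c1; apply/cP/(word_congr1 congR).
  by move=> a b; rewrite -cM; apply/esym/cP/(word_congrM congR).
have E u : phi (eval_word iota u) = c u.
  elim: u => [|x u IHu] /=; first by rewrite phi1 c1.
  by rewrite phiM phiE IHu -cM; case: x.
by apply/cP; rewrite -!E ww'.
Qed.

(** For [R] equality of values, the quotient maps to [G] by [e]. The composite from [G] through the
    quotient to [G] extends [iota], hence is the identity by uniqueness. *)
Lemma eval_word_surj g : exists w, eval_word iota w = g.
Proof.
have iotaM := fp.1; pose R u v := eval_word iota u = eval_word iota v.
have congR : word_congruence R.
  split; rewrite /R; try by [|move=> ? ? -> | move=> ? ? ? -> ->].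
  - by move=> u u' v v' uu' vv'; rewrite !eval_word_cat uu' vv'.
  - by move=> j /=; rewrite mulg1 (iotaM j).1.
  - by move=> j a b /=; rewrite !mulg1 (iotaM j).2.
have [H [c [r [cP rK cM]]]] := word_quotient congR.
have c1 : c [::] = 1 by apply: (mulgI (c [::])); rewrite -cM mulg1.
pose e q := eval_word iota (r q).
have ec w : e (c w) = eval_word iota w by apply/cP; rewrite rK.
have e1 : e 1 = 1 by rewrite -c1 ec.
have eM : {morph e : x y / x * y}.
  by move=> x y; rewrite -[x]rK -[y]rK -cM !ec eval_word_cat.
case: fp => _ /[dup] univ /(_ H (fun j a => c [:: existT A j a])) [j|phi [[[phi1 phiM] phiE] _]].
  split; first by rewrite -c1; apply/cP/(word_congr1 congR).
  by move=> a b; rewrite -cM; apply/esym/cP/(word_congrM congR).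
have [psi [_ psi_uniq]] := univ G iota iotaM.
exists (r (phi g)); rewrite -/(e _).
transitivity (psi g); last by rewrite -(psi_uniq id).
apply: (psi_uniq (e \o phi)).
- by split=> [|x y] /=; rewrite ?phi1 ?e1 // phiM eM.
- by move=> j a /=; rewrite phiE ec /= mulg1.
Qed.

End FreeProductWords.

(** * Counting discs *)

Section OrbitCount.
Variables (X : finType) (s : {perm X}) (f : X -> nat) (T : nat).
Implicit Types (O : {set X}) (P : {set X}) (K : {set {set X}}).

Definition ascent x := (f x < f (s x))%N.
Definition low x := (f x + f (s x) < T)%N.
Definition count_in (a : pred X) O := (\sum_(x in O) a x)%N.
Definition orbit_constant O := [forall x in O, f (s x) == f x].

Lemma count_in_eq0 a O x : count_in a O = 0%N -> x \in O -> a x = false.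
Proof. by move/eqP; rewrite sum_nat_eq0 => /forall_inP/[apply]; case: (a x). Qed.

(** Going on around the cycle leads from [s y] back to [y], so the reverse relation follows by
    transitivity. *)
Lemma orbit_mono (le : rel nat) (g : X -> nat) x :
  reflexive le -> transitive le ->
  {in porbit s x, forall y, le (g y) (g (s y))} ->
  {in porbit s x, forall y, le (g (s y)) (g y)}.
Proof.
move=> le_refl le_trans mono y yx.
have E : porbit s y = porbit s x by apply/eqP; rewrite eq_porbit_mem.
rewrite -E in mono; have iterle i : le (g (s y)) (g (iter i s (s y))).
  elim: i => [|i IHi] //=; apply: le_trans IHi (mono _ _).
  by rewrite -iterSr -permX mem_porbit.
have := iter_porbit s y; rewrite -[#|_|]prednK ?lt0n ?card_porbit_neq0 // iterSr => yE.
by rewrite -{2}yE; apply: iterle.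
Qed.

(* The distance from [4 * i] to the midpoint [2 * T - 1]: if along an orbit the ascents are
   exactly the low steps (or exactly the high ones), it changes monotonically. *)
Let key i := (2 * T - 1 - 4 * i + (4 * i - (2 * T - 1)))%N.

Definition asc_low := count_in [pred y | ascent y & low y].
Definition asc_high := count_in [pred y | ascent y & ~~ low y].
Definition desc_low := count_in [pred y | ~~ ascent y & low y].
Definition desc_high := count_in [pred y | ~~ ascent y & ~~ low y].

(** According to which truncated differences are positive, the claim needs [la + ha], [ld + hd],
    [ld + ha] or [hd + la] to be positive. If one of these vanished, [f] or [key \o f] would be
    monotone around the orbit, hence constant; [key] is injective because its midpoint is odd. *)
Lemma nonconstant_orbit x : (0 < T)%N -> ~~ orbit_constant (porbit s x) ->
  let O := porbit s x in
  is_true (1 + ((asc_low O - desc_low O) + (asc_high O - desc_high O))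
             <= asc_low O + asc_high O)%N.
Proof.
move=> T_gt0 nconst O; set la := asc_low O; set ha := asc_high O.
set ld := desc_low O; set hd := desc_high O.
have const (le : rel nat) (g : X -> nat) : reflexive le -> transitive le ->
    {in O, forall y, le (g y) (g (s y))} ->
    {in O, forall y, le (g (s y)) (g y) -> f (s y) = f y} -> False.
  move=> le_refl le_trans mono eqf; case/negP: nconst; apply/forall_inP => y yO.
  by rewrite eqf // (orbit_mono le_refl le_trans mono).
have geq_trans : transitive geq by move=> b a c ab bc; apply: leq_trans bc ab.
have asc : (0 < la + ha)%N.
  rewrite lt0n addn_eq0; apply/negP => /andP[/eqP la0 /eqP ha0].
  have nasc y : y \in O -> (f (s y) <= f y)%N.
    move=> yO; have := count_in_eq0 la0 yO; have := count_in_eq0 ha0 yO.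
    by rewrite /= leqNgt -/(ascent y); case: (ascent y) (low y) => [] [].
  apply: (const geq f leqnn geq_trans) => y /nasc //= ? ?.
  by apply/eqP; rewrite eqn_leq; apply/andP.
have desc : (0 < ld + hd)%N.
  rewrite lt0n addn_eq0; apply/negP => /andP[/eqP ld0 /eqP hd0].
  have yasc y : y \in O -> (f y < f (s y))%N.
    move=> yO; have := count_in_eq0 ld0 yO; have := count_in_eq0 hd0 yO.
    by rewrite /= -/(ascent y); case: (ascent y) (low y) => [] [].
  apply: (const leq f leqnn leq_trans); first by move=> y /yasc/ltnW.
  by move=> y /yasc; rewrite ltnNge => /negP.
have ld_ha : (0 < ld + ha)%N.
  rewrite lt0n addn_eq0; apply/negP => /andP[/eqP ld0 /eqP ha0].
  have cases y : y \in O -> ascent y = low y.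
    move=> yO; have := count_in_eq0 ld0 yO; have := count_in_eq0 ha0 yO.
    by rewrite /=; case: (ascent y) (low y) => [] [].
  by apply: (const geq (key \o f) leqnn geq_trans) => y /cases; rewrite /ascent /low /key /=; lia.
have hd_la : (0 < hd + la)%N.
  rewrite lt0n addn_eq0; apply/negP => /andP[/eqP hd0 /eqP la0].
  have cases y : y \in O -> ascent y = ~~ low y.
    move=> yO; have := count_in_eq0 hd0 yO; have := count_in_eq0 la0 yO.
    by rewrite /=; case: (ascent y) (low y) => [] [].
  by apply: (const leq (key \o f) leqnn leq_trans) => y /cases; rewrite /ascent /low /key /=; lia.
lia.
Qed.

Lemma orbit_constant_eq x y z : orbit_constant (porbit s x) ->
  y \in porbit s x -> z \in porbit s x -> f y = f z.
Proof.
move=> /forall_inP cO; suff E t : t \in porbit s x -> f t = f x.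
  by move=> /E-> /E->.
case/porbitP=> i ->; elim: i => [|i IHi]; first by rewrite perm1.
by rewrite expgSr permM (eqP (cO _ (mem_porbit _ _ _))).
Qed.

Lemma count_in_orbits a P : {in P, forall x, s x \in P} ->
  count_in a P = (\sum_(O in [set porbit s x | x in P]) count_in a O)%N.
Proof.
move=> stab; rewrite /count_in (partition_big (porbit s) (mem [set porbit s x | x in P])) /=.
  apply: eq_bigr => _ /imsetP[z zP ->]; apply: eq_bigl => x.
  rewrite eq_porbit_mem andb_idl // => /porbitP[i ->].
  by elim: i => [|i IHi]; rewrite ?perm1 // expgSr permM stab.
by move=> x xP; apply: imset_f.
Qed.

(** Here [nc] counts the non-constant orbits, [cl] and [ch] the constant ones in [K] with only low
    or only high steps, while [L] and [H] add up the excesses of low and of high ascents. *)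
Lemma orbit_count P K N : (0 < T)%N -> {in P, forall x, s x \in P} ->
  K \subset [set porbit s x | x in P] ->
  {in P, forall x, porbit s x \in K -> orbit_constant (porbit s x) -> N <= #|porbit s x|}%N ->
  exists nc L H cl ch,
    [/\ #|K| <= nc + cl + ch, nc + (L + H) <= asc_low P + asc_high P,
        N * cl + asc_low P <= desc_low P + L & N * ch + asc_high P <= desc_high P + H]%N.
Proof.
move=> T_gt0 stab sub_K const_K; set S := [set porbit s x | x in P].
pose const_low O := orbit_constant O && [forall x in O, low x].
exists (\sum_(O in S) ~~ orbit_constant O)%N.
exists (\sum_(O in S) (asc_low O - desc_low O))%N, (\sum_(O in S) (asc_high O - desc_high O))%N.
exists (\sum_(O in S) ((O \in K) && const_low O))%N.
exists (\sum_(O in S) ((O \in K) && (orbit_constant O && ~~ const_low O)))%N.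
have const_asc O : orbit_constant O -> forall x, x \in O -> ascent x = false.
  by move=> /forall_inP cO x /cO/eqP fx; rewrite /ascent fx ltnn.
rewrite /asc_low /asc_high /desc_low /desc_high !(count_in_orbits _ stab).
split.
- rewrite -sum1_card -!big_split big_mkcond [X in (_ <= X)%N]big_mkcond.
  apply: leq_sum => O _.
  have [OK|//] := boolP (O \in K); rewrite (subsetP sub_K) // /const_low.
  by case: (orbit_constant O); case: [forall x in O, low x].
- rewrite -!big_split; apply: leq_sum => _ /imsetP[x _ ->].
  have [cO|nO] := boolP (orbit_constant (porbit s x)); last exact: nonconstant_orbit nO.
  rewrite /= [X in (X - _)%N]big1 => [|y yO]; last by rewrite /= (const_asc _ cO).
  by rewrite [X in (_ + (X - _))%N]big1 => [|y yO]; last by rewrite /= (const_asc _ cO).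
- rewrite big_distrr -!big_split; apply: leq_sum => _ /imsetP[x xP ->] /=.
  have [/andP[OK /andP[cO /forall_inP lO]]|_] := boolP (_ && _); last first.
    by rewrite muln0; lia.
  rewrite muln1 [X in (_ + X)%N]big1 => [|y yO]; last by rewrite /= (const_asc _ cO).
  rewrite addn0 (leq_trans (const_K x xP OK cO)) // (leq_trans _ (leq_addr _ _)) //.
  by rewrite -sum1_card; apply: leq_sum => y yO; rewrite /= (const_asc _ cO) // lO.
- rewrite big_distrr -!big_split; apply: leq_sum => _ /imsetP[x xP ->] /=.
  have [/andP[OK /andP[cO nlO]]|_] := boolP (_ && _); last first.
    by rewrite muln0; lia.
  rewrite muln1 [X in (_ + X)%N]big1 => [|y yO]; last by rewrite /= (const_asc _ cO).
  rewrite addn0 (leq_trans (const_K x xP OK cO)) // (leq_trans _ (leq_addr _ _)) //.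
  rewrite -sum1_card; apply: leq_sum => y yO; rewrite /= (const_asc _ cO) //=.
  suff -> : low y = false by [].
  apply: contraNF nlO => ly; rewrite /const_low cO; apply/forall_inP => z zO.
  move: ly; rewrite /low (eqP (forall_inP cO _ yO)) (eqP (forall_inP cO _ zO)).
  by rewrite (orbit_constant_eq cO zO yO).
Qed.

End OrbitCount.

Lemma nth_flatten_nseq (L : Type) (x0 : L) (w : seq L) n i : (i < n * size w)%N ->
  nth x0 (flatten (nseq n w)) i = nth x0 w (i %% size w).
Proof.
elim: n i => // n IHn i; rewrite mulSn /= nth_cat => lti.
case: ltnP => [lt|ge]; first by rewrite modn_small.
by rewrite IHn ?ltn_subLR // -[in RHS](subnKC ge) modnDl.
Qed.

Lemma size_flatten_nseq (L : Type) (w : seq L) n : size (flatten (nseq n w)) = (n * size w)%N.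
Proof. by elim: n => //= n IHn; rewrite size_cat IHn mulSn. Qed.

Lemma leq_div_add N c n l : (0 < N)%N -> (N * c <= n + l)%N -> (c <= n %/ N + l)%N.
Proof.
move=> N_gt0 le; rewrite addnC -leq_subLR leq_divRL // mulnBl leq_subLR mulnC.
by rewrite (leq_trans le) // addnC leq_add2r leq_pmulr.
Qed.

Lemma sum_index (X : finType) (p : seq X) (F : nat -> nat) : uniq p ->
  (\sum_(x in [set x in p]) F (index x p) = \sum_(0 <= i < size p) F i)%N.
Proof.
move=> up; rewrite (eq_bigl (mem p)) => [|x]; last by rewrite inE.
rewrite -big_uniq //; case: p up => [|x0 p] up; first by rewrite big_nil big_geq.
rewrite (big_nth x0) big_nat_cond [RHS]big_nat_cond.
by apply: eq_bigr => i /andP[/andP[_ lti] _]; rewrite index_uniq.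
Qed.

Lemma sum_multiples m n : (0 < m)%N -> (\sum_(0 <= i < n * m) (i %% m == 0) = n)%N.
Proof.
move=> m_gt0; elim: n => [|n IHn]; first by rewrite big_geq.
rewrite mulSnr (big_cat_nat (n := n * m)) ?leq_addr //= IHn -addn1; congr addn.
rewrite -{1}[(n * m)%N]add0n big_addn addKn big_ltn // add0n modnMl eqxx.
rewrite big_nat_cond big1 // => i /andP[/andP[i_gt0 lti] _].
by rewrite addnC modnMDl modn_small //; case: i i_gt0 {lti}.
Qed.

Lemma card_porbits_live (X : finType) (s : {perm X}) (P : {set X}) (K : {set {set X}}) :
  K \subset porbits s ->
  (#|K| <= #|K :&: [set porbit s x | x in P]| + #|~: P|)%N.
Proof.
move=> sub_K.
apply: leq_trans (_ : #|(K :&: [set porbit s x | x in P]) :|: porbit s @: ~: P| <= _)%N.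
  apply/subset_leq_card/subsetP => O OK; have /imsetP[x _ OE] := subsetP sub_K O OK.
  rewrite !inE OK /=; have [xP|xP] := boolP (x \in P).
    by rewrite OE imset_f.
  by rewrite OE [X in _ || X]imset_f ?orbT // inE.
by rewrite cardsU (leq_trans (leq_subr _ _)) // leq_add2l leq_imset_card.
Qed.

(** * The genus bound for powers of a cyclically alternating word *)

Section PowerBound.
Variables (J : Type) (A : J -> groupType) (G : groupType) (iota : forall j, A j -> G).
Local Notation letter := {j : J & A j}.

Lemma power_surface (w : seq letter) (x0 : letter) n k N :
  (1 < size w)%N -> (0 < N)%N ->
  (forall i, (i < size w)%N -> tag (nth x0 w i) <> tag (nth x0 w (i.+1 %% size w))) ->
  (forall i d, (i < size w)%N -> (0 < d)%N ->
     letter_val iota (nth x0 w i) ^+ d = 1 -> (N <= d)%N) ->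
  (0 < n)%N -> bounds iota k (flatten (nseq n w)) ->
  (n + 1 <= 2 * k + 2 * (n %/ N))%N.
Proof.
set m := size w => m_gt1 N_gt0 alt ordN n_gt0 [X [lab [p [s [h [wE [up dead tags genus]]]]]]].
have m_gt0 : (0 < m)%N := ltnW m_gt1.
have sz : size p = (n * m)%N by rewrite -(size_map lab) wE size_flatten_nseq.
have sz_gt0 : (0 < size p)%N by rewrite sz muln_gt0 n_gt0.
pose c := cycle_perm p; pose P := [set x in p].
pose ind x := (index x p %% m)%N.
have ind_lt x : (ind x < m)%N by rewrite ltn_mod.
have PE x : (x \in P) = (x \in p) by rewrite inE.
have labE x : x \in P -> lab x = nth x0 w (ind x).
  rewrite PE => xp; have lt : (index x p < size p)%N by rewrite index_mem.
  by rewrite -(nth_flatten_nseq x0 (n := n)) -?sz // -wE (nth_map x) // nth_index.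
have cP x : x \in P -> c x \in P.
  rewrite !PE => xp; apply: contraTT (xp) => cx.
  have := cycle_perm_out cx; rewrite -/c => /perm_inj ccx; by rewrite -ccx.
have cVP x : x \in P -> c^-1 x \in P.
  rewrite !PE => xp; apply: contraTT (xp) => cx.
  by have := cycle_perm_out cx; rewrite -/c permKV => ->.
have indc x : x \in P -> ind (c x) = ((ind x).+1 %% m)%N.
  rewrite PE => xp; have lt : (index x p < size p)%N by rewrite index_mem.
  rewrite /ind -{1}(nth_index x xp) cycle_perm_nth // index_uniq ?ltn_mod //.
  rewrite sz modn_dvdm ?dvdn_mull //.
  by rewrite -addn1 -[in RHS]addn1 modnDml.
have sP x : x \in P -> s x \in P.
  rewrite !PE => xp; apply: contraTT (xp) => /[dup] sx /dead[/perm_inj ssx _].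
  by rewrite -ssx.
have sVP x : x \in P -> s^-1 x \in P.
  rewrite !PE => xp; apply: contraTT (xp) => /[dup] sx /dead[+ _].
  by rewrite permKV => ->.
(* The central pieces are followed backwards and indexed by the preceding letter. When [s] goes from
   index [i] to [j > 0], the matching step of [t] goes from [j - 1] to [i]: exactly one of them
   ascends, and the thresholds [m] and [m.-1] make both low or both high. *)
pose t := s^-1 * c; pose indB y := ind (c^-1 y).
pose KA := good_orbits (letter_val iota \o lab) s h :&: [set porbit s x | x in P].
pose KB := porbits t :&: [set porbit t x | x in P].
have tP x : x \in P -> t x \in P by move=> xP; rewrite permM cP // sVP.
have cardA : (#|good_orbits (letter_val iota \o lab) s h| <= #|KA| + #|~: P|)%N.
  by apply: card_porbits_live; apply/subsetP => O /good_porbits.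
have cardB : (#|porbits (c^-1 * s)| <= #|KB| + #|~: P|)%N.
  rewrite -porbitsV invgM invgK; exact: card_porbits_live.
have cardX : #|X| = (n * m + #|~: P|)%N.
  by rewrite -(cardsC P) -sz cardsE (card_uniqP up).
have /= := orbit_count (s := s) (f := ind) (T := m) (P := P) (K := KA) (N := N) m_gt0 sP.
case=> [|x xP OK cO|ncA [LA [HA [clA [chA [KA_le ascA lowA highA]]]]]].
- exact: subsetIr.
(* All letters of a constant disc are one and the same letter of [w], and its power with exponent
   the size of the disc is trivial. *)
- have ord := ordN (ind x) #|porbit s x| (ind_lt x).
  apply: ord; first by rewrite lt0n card_porbit_neq0.
  move: OK; rewrite inE => /andP[/good_orbitsP[z OE gz] _].
  rewrite -OE in gz; have val y : y \in porbit s x ->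
      letter_val iota (lab y) = letter_val iota (nth x0 w (ind x)).
    move=> yO; rewrite labE ?(orbit_constant_eq cO yO (porbit_id _ _)) //.
    case/porbitP: yO => i ->; elim: i => [|i IHi]; rewrite ?perm1 // expgSr permM sP //.
  have it i : h (iter i s x) = h x * letter_val iota (nth x0 w (ind x)) ^+ i.
    elim: i => [|i IHi]; first by rewrite mulg1.
    rewrite iterS gz -?permX ?mem_porbit // permX /= val -?permX ?mem_porbit // permX.
    by rewrite IHi expgSr mulgA.
  have := it #|porbit s x|; rewrite iter_porbit => /esym hx.
  by apply: (mulgI (h x)); rewrite hx mulg1.
have T_gt0 : (0 < m.-1)%N by rewrite -subn1 subn_gt0.
have /= := orbit_count (s := t) (f := indB) (T := m.-1) (P := P) (K := KB) (N := N) T_gt0 tP.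
case=> [|y yP _ cO|ncB [LB [HB [clB [chB [KB_le ascB lowB highB]]]]]].
- exact: subsetIr.
(* A constant central orbit would make [s] pass to the cyclically next letter of [w], which lies in
   another factor. *)
- have := forall_inP cO y (porbit_id _ _); rewrite /indB permM permK => /eqP E.
  pose x := s^-1 y; have xP : x \in P by apply: sVP.
  have := alt (ind x) (ind_lt x); rewrite -labE // {1}/x E -indc ?cVP // permKV -labE //.
  by rewrite -(tags x) permKV.
have reindex a : count_in a P = count_in (a \o s) P.
  rewrite /count_in [LHS](reindex_inj (@perm_inj _ s)) /=; apply: eq_bigl => x.
  by apply/idP/idP => [/sVP|/sP//]; rewrite permK.
(* A step of [s] to index [0] is a low descent, and the matching step of [t] leaves [m - 1] and is a
   high descent. These [n] pairs are the surplus of descents in [lowE] and [highE]. *)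
have sum0 : (\sum_(x in P) (ind (s x) == 0) = n)%N.
  have := reindex [pred x | ind x == 0%N]; rewrite /count_in /= => <-.
  by rewrite (sum_index (fun i => (i %% m == 0)%N : nat)) // sz sum_multiples.
have table x : x \in P -> [/\ (ind x < m)%N, (ind (s x) < m)%N, indB (t (s x)) = ind x &
    if ind (s x) == 0%N then indB (s x) = m.-1 else (indB (s x)).+1 = ind (s x)].
  move=> xP; split=> //; first by rewrite /indB permM permK permK.
  have := indc _ (cVP _ (sP _ xP)); rewrite permKV -/(indB _) => ->.
  have : (indB (s x) < m)%N := ind_lt _.
  rewrite leq_eqVlt => /predU1P[E|lt]; last by rewrite modn_small.
  by rewrite E modnn -E.
have countE F1 F2 F3 F4 F5 : (forall x, x \in P -> F1 x + F2 x = F3 x + F4 x + F5 x)%N ->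
  (\sum_(x in P) F1 x + \sum_(x in P) F2 x =
   \sum_(x in P) F3 x + \sum_(x in P) F4 x + \sum_(x in P) F5 x)%N.
  by move=> FE; rewrite -!big_split; apply: eq_bigr => x /FE.
have lowE : (desc_low s ind m P + desc_low t indB m.-1 P =
             asc_low s ind m P + asc_low t indB m.-1 P + n)%N.
  rewrite [desc_low t _ _ _]reindex [asc_low t _ _ _]reindex -{}sum0.
  apply: countE => x /table[] /=; rewrite /ascent /low => ltx lty ->.
  by move: (indB (s x)) (ind (s x)) (ind x) ltx lty => kx jx ix ltx lty; case: eqP => /=; lia.
have highE : (desc_high s ind m P + desc_high t indB m.-1 P =
             asc_high s ind m P + asc_high t indB m.-1 P + n)%N.
  rewrite [desc_high t _ _ _]reindex [asc_high t _ _ _]reindex -{}sum0.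
  apply: countE => x /table[] /=; rewrite /ascent /low => ltx lty ->.
  by move: (indB (s x)) (ind (s x)) (ind x) ltx lty => kx jx ix ltx lty; case: eqP => /=; lia.
have totE : (asc_low s ind m P + asc_high s ind m P + asc_low t indB m.-1 P
             + asc_high t indB m.-1 P + n = n * m)%N.
  have <- : (\sum_(x in P) 1 = n * m)%N by rewrite sum1_card cardsE (card_uniqP up).
  rewrite [asc_low t _ _ _]reindex [asc_high t _ _ _]reindex -{}sum0.
  rewrite /asc_low /asc_high /count_in -!big_split; apply: eq_bigr => x /table[] /=.
  rewrite /ascent /low => ltx lty ->.
  by move: (indB (s x)) (ind (s x)) (ind x) ltx lty => kx jx ix ltx lty; case: eqP => /=; lia.
(* The excesses added here are the ones already subtracted from the number of ascents in [ascA] and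
   [ascB], so they cancel at the end. *)
have clE : (clA + clB <= n %/ N + (LA + LB))%N.
  by apply: leq_div_add => //; move: lowA lowB lowE; rewrite mulnDr; lia.
have chE : (chA + chB <= n %/ N + (HA + HB))%N.
  by apply: leq_div_add => //; move: highA highB highE; rewrite mulnDr; lia.
move: genus; rewrite /euler_count sz cardX (gtn_eqF (_ : 0 < n * m)%N) -?sz //.
rewrite -/c; move: cardA cardB KA_le KB_le ascA ascB totE clE chE.
move: #|_| #|_| #|_| #|_| #|_| (asc_low _ _ _ _) (asc_low _ _ _ _).
move: (asc_high _ _ _ _) (asc_high _ _ _ _).
move=> *; lia.
Qed.

End PowerBound.

(** * Commutator length of powers *)

Section LowerBound.
Variables (J : Type) (A : J -> groupType) (G : groupType) (iota : forall j, A j -> G).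
Hypothesis fp : is_free_product iota.
Local Notation letter := {j : J & A j}.
Implicit Types (u v w : seq letter) (k n : nat).

Lemma bounds_eval k w w' : eval_word iota w = eval_word iota w' ->
  bounds iota k w -> bounds iota k w'.
Proof.
move=> ww'; have iotaM := fp.1.
(* Being interchangeable in every context and for every genus is a congruence, so it contains
   equality of values. *)
pose R w w' := forall u v k, bounds iota k (u ++ w ++ v) <-> bounds iota k (u ++ w' ++ v).
suff congR : word_congruence R.
  by have := eval_word_congr fp congR ww' [::] [::] k; rewrite /= !cats0 => -[].
split; rewrite /R.
- by [].
- by move=> v v' vv' u t l; split=> /vv'.
- by move=> v1 v2 v3 H12 H23 u t l; rewrite H12.
- by move=> v1 v1' v2 v2' H1 H2 u t l; rewrite -!catA H1 !catA -!(catA _ _ t) -(catA u v1') catA H2.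
- by move=> j u v l; rewrite (bounds_insert iotaM).
- by move=> j a b u v l; rewrite (bounds_merge iotaM).
Qed.

Lemma eval_inv_word w : eval_word iota (inv_word w) = (eval_word iota w)^-1.
Proof.
apply/esym/mulg1_eq; rewrite -eval_word_cat.
have iotaM := fp.1; elim: w => [|x w IHw] //.
rewrite inv_word_cons cat_cons catA /= eval_word_cat IHw mul1g /= mulg1.
by rewrite -(iotaM _).2 mulgV (iotaM _).1.
Qed.

Lemma bounds_commutators w k : prod_commutators (eval_word iota w) k -> bounds iota k w.
Proof.
case=> s [<-]; elim: s w => [|[x y] s IHs] w /= wE.
  exact: (@bounds_eval _ [::]) (bounds_nil _ _).
have [[u ux] [v vy]] := (eval_word_surj fp x, eval_word_surj fp y).
have [w0 w0E] := eval_word_surj fp (foldr (fun p acc => [~ p.1, p.2] * acc) 1 s).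
pose z := inv_word u ++ inv_word v.
(* The word [inv_word u ++ inv_word v ++ v ++ u ++ w0] has the value of [w0]; exchanging [v] and [u]
   then creates the commutator for one handle. *)
have H : bounds iota (size s) (z ++ v ++ u ++ w0).
  apply: bounds_eval (IHs w0 w0E).
  by rewrite !eval_word_cat !eval_inv_word -!mulgA !mulKg.
have {}H : bounds iota (size s).+1 ((u ++ v ++ w0) ++ z).
  by rewrite -!catA; apply: bounds_swap; have := bounds_rot H; rewrite -!catA.
apply: bounds_eval (bounds_rot H).
by rewrite wE !eval_word_cat !eval_inv_word w0E ux vy /commg /conjg !mulgA.
Qed.

(** The universal property is applied to the identity on [A j] and the trivial morphism on the other
    factors. *)
Lemma retraction j : exists r : G -> A j,
  [/\ monoid_morphism r, forall a, r (iota a) = a &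
      forall i (b : A i), i <> j -> r (iota b) = 1].
Proof.
pose f i : A i -> A j :=
  if pselect (i = j) is left e then fun a => eq_rect i (fun i => A i) a j e else fun => 1.
have fM i : monoid_morphism (f i).
  rewrite /f; case: pselect => [e|_]; first by subst i.
  by split=> [|a b] //=; rewrite mulg1.
have [r [[rM rE] _]] := fp.2 _ f fM; exists r; split=> // [a|i b ij]; rewrite rE /f.
  by case: pselect => // e; rewrite (Prop_irrelevance e erefl).
by case: pselect.
Qed.

Lemma iota_eq1 j (a : A j) : iota a = 1 -> a = 1.
Proof. by have [r [[r1 _] rK _]] := retraction j; rewrite -{2}[a]rK => ->. Qed.

Lemma letter_order_le (x : letter) N d : (forall o, elt_order (tagged x) o -> ole N o) ->
  (0 < d)%N -> letter_val iota x ^+ d = 1 -> exists2 m, N = Some m & (m <= d)%N.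
Proof.
move=> minN d_gt0; rewrite /letter_val.
have -> : iota (tagged x) ^+ d = iota (tagged x ^+ d).
  have [i1 iM] := fp.1 (tag x).
  by elim: (d) => [|i IHi]; rewrite ?i1 // !expgS iM IHi.
move=> /iota_eq1 xd; have exP : exists i, (0 < i)%N && (tagged x ^+ i == 1).
  by exists d; rewrite d_gt0 xd eqxx.
have ord : elt_order (tagged x) (Some (ex_minn exP)).
  case: ex_minnP => i /andP[i_gt0 /eqP xi] mini; split=> //; split=> // l l_gt0 xl.
  by apply: mini; rewrite l_gt0 xl eqxx.
have := minN _ ord; case: N {minN} => //= m; case: ex_minnP {ord} => i _ mini le_mi.
by exists m => //; apply: leq_trans le_mi _; apply: mini; rewrite d_gt0 xd eqxx.
Qed.

Lemma cyclically_reduced_nth w x0 i : cyclically_reduced w -> (i < size w)%N ->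
  tag (nth x0 w i) <> tag (nth x0 w (i.+1 %% size w)).
Proof.
case=> _ [_ [alt wrap]] lti; have [lt|ge] := ltnP i.+1 (size w).
  rewrite modn_small //; elim: w i alt lt {wrap lti} => [|x [|y w] IHw] // [|i] [xy alt] lt //=.
  exact: (IHw i alt lt).
have -> : i = (size w).-1 by lia.
rewrite nth_last prednK ?modnn; last by lia.
by case: w wrap lti {alt ge}.
Qed.

Lemma in_nth w (x0 : letter) i : (i < size w)%N -> List.In (nth x0 w i) w.
Proof. by elim: w i => // x w IHw [|i] lti /=; [left | right; apply: IHw]. Qed.

Lemma elt_order_gt1 (B : groupType) (b : B) m : b <> 1 -> elt_order b (Some m) -> (1 < m)%N.
Proof. by move=> b1 [m_gt0 [bm _]]; case: m m_gt0 bm => [|[|m]] // _; rewrite expg1. Qed.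

Lemma power_commutators w n N k : cyclically_reduced w ->
  (exists x, List.In x w /\ elt_order (tagged x) N) ->
  (forall x o, List.In x w -> elt_order (tagged x) o -> ole N o) ->
  (0 < n)%N -> prod_commutators (eval_word iota w ^+ n) k ->
  (n %/ 2 - ofloor_div n N + 1 <= k)%N.
Proof.
move=> wred [x [xw xN]] minN n_gt0 wk.
have powE : eval_word iota w ^+ n = eval_word iota (flatten (nseq n w)).
  by elim: (n) => [|i IHi] //=; rewrite eval_word_cat -IHi expgS.
rewrite powE in wk; have {}wk := bounds_commutators wk.
(* Infinite order is replaced by [n.+1], which makes the quotient [0]. *)
pose N' := if N is Some m then m else n.+1.
have -> : ofloor_div n N = (n %/ N')%N by rewrite /N'; case: (N) => //=; rewrite divn_small.
have [w_gt1 [w_neq1 _]] := wred.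
have N'_gt1 : (1 < N')%N.
  by rewrite /N'; case: (N) (xN) => // m; apply: elt_order_gt1; apply: w_neq1.
(* The bound [n %/ N' <= n %/ 2] keeps the truncated subtraction exact. *)
suff : (n + 1 <= 2 * k + 2 * (n %/ N'))%N by have := leq_div2l n (isT : 0 < 2)%N N'_gt1; lia.
apply: (power_surface (x0 := x) w_gt1 _ _ _ n_gt0 wk).
- exact: ltnW.
- by move=> i; apply: cyclically_reduced_nth.
move=> i d lti d_gt0 xd; have iw := in_nth x lti.
by have [m NE md] := letter_order_le (fun o => minN _ o iw) d_gt0 xd; rewrite /N' NE.
Qed.

Lemma elt_orderV (B : groupType) (b : B) o : elt_order b^-1 o -> elt_order b o.
Proof.
have E i : b^-1 ^+ i = 1 <-> b ^+ i = 1.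
  by rewrite expVgn; split=> [/eqP|->]; rewrite ?invg1 // invg_eq1 => /eqP.
case: o => [m|] /=; last by move=> H i i_gt0 /E; apply: H.
by move=> [m_gt0 [/E bm minm]]; split=> //; split=> // i i_gt0 /E; apply: minm.
Qed.

(** Every retraction onto a factor kills this commutator, so a factor element conjugate to the power
    would be trivial, and the power with it. *)
Lemma commutator_in_Ghat i j (a : A i) (b : A j) n : i <> j ->
  [~ iota a, iota b] ^+ n <> 1 -> in_Ghat iota ([~ iota a, iota b] ^+ n).
Proof.
move=> ij gn1 l c [z gE]; have [r [[r1 rM] rK r_out]] := retraction l.
have rV x : r x^-1 = (r x)^-1 by apply/esym/mulg1_eq; rewrite -rM mulgV r1.
have rc : r [~ iota a, iota b] = 1.
  rewrite /commg /conjg !rM !rV; have [il|il] := EM (i = l).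
    by rewrite (r_out j) ?invg1 ?mul1g ?mulg1 ?mulVg // -il => /esym.
  by rewrite (r_out i) ?invg1 ?mul1g ?mulg1 ?mulVg.
have rn : r ([~ iota a, iota b] ^+ n) = 1.
  by elim: (n) => [|e IHe]; rewrite ?r1 // expgS rM rc IHe mulg1.
have c1 : c = 1.
  move: rn; rewrite gE conjgE !rM rV rK => /eqP.
  by rewrite -conjgE conjg_eq1 => /eqP.
by apply: gn1; rewrite gE c1 (fp.1 l).1 conj1g.
Qed.

End LowerBound.

Theorem theorem2 (J : Type) (A : J -> groupType) (G : groupType)
  (iota : forall j, A j -> G) (n : nat) (N : option nat) :
  is_free_product iota ->
  (forall j, exists a : A j, a <> 1) ->
  (0 < n)%N ->
  (exists g : G, NG iota g N) ->
  is_kGnN iota n N ((n %/ 2)%N - ofloor_div n N + 1)%N.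
Proof.
move=> fp _ n_gt0 [g0 [_ [w0 [w0red [_ [[x [xw xN]] minN]]]]]].
split; last first.
  move=> g k [_ [w [wred [[h gE] [wN wmin]]]]] _.
  rewrite gE -conjXg => /prod_commutators_conjV.
  by move=> gk; apply: (power_commutators fp wred wN wmin n_gt0 gk).
have [w0_gt1 [w0_neq1 [w0_alt _]]] := w0red.
(* The first two letters lie in different factors, so one of them is outside the factor of [x]. *)
have [y yw xy] : exists2 y, List.In y w0 & tag x <> tag y.
  case: w0 w0_gt1 w0_alt {xw minN w0red w0_neq1} => [|u [|v t]] // _ [uv _].
  have [xu|xu] := EM (tag x = tag u); last by exists u => //; left.
  by exists v; [right; left | rewrite xu].
have [x1 y1] := (w0_neq1 x xw, w0_neq1 y yw).
case: x y xN xw yw xy x1 y1 => i a [j b] /= aN aw bw ij a1 b1.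
(* The extremal element is the commutator of a letter of minimal order with a letter of another
   factor; inversion preserves orders, so the minimum is still [N]. *)
pose w := [:: existT A i a^-1; existT A j b^-1; existT A i a; existT A j b].
have iV l (e : A l) : iota l e^-1 = (iota l e)^-1.
  by apply/esym/mulg1_eq; rewrite -(fp.1 l).2 mulgV (fp.1 l).1.
have wE : eval_word iota w = [~ iota i a, iota j b].
  by rewrite /= !iV /commg /conjg mulg1 !mulgA.
have wred : cyclically_reduced w.
  have inv1 (B : groupType) (e : B) : e <> 1 -> e^-1 <> 1.
    by move=> e1 /eqP; rewrite invg_eq1 => /eqP.
  split=> //; split.
    by move=> z /= [<-|[<-|[<-|[<-|[]]]]] //=; apply: inv1.
  by split=> /=; [do !split=> //; exact: nesym | exact: nesym].
have wN : exists z, List.In z w /\ elt_order (tagged z) N.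
  by exists (existT A i a); split=> //=; right; right; left.
have wmin z o : List.In z w -> elt_order (tagged z) o -> ole N o.
  move=> /= [<-|[<-|[<-|[<-|[]]]]] /= zo; first exact: minN aw (elt_orderV zo).
  - exact: minN bw (elt_orderV zo).
  - exact: minN aw zo.
  - exact: minN bw zo.
(* A trivial power would be a product of zero commutators, against the lower bound, which is at
   least one. *)
have hat l : (0 < l)%N -> in_Ghat iota ([~ iota i a, iota j b] ^+ l).
  move=> l_gt0; apply: commutator_in_Ghat => // l1.
  have := power_commutators fp wred wN wmin l_gt0 (k := 0%N).
  by rewrite wE l1 addn1 => /(_ (prod_commutators0 G)).
exists [~ iota i a, iota j b]; split; last split; last 1 first.
- case: N aN {minN wN wmin} => [m|] aN /=; last by rewrite subn0; apply: comm_pow_infinite.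
  apply: comm_pow_torsion (elt_order_gt1 a1 aN) n_gt0.
  case: aN => _ [am _]; rewrite -[RHS](fp.1 i).1 -am.
  by elim: (m) => [|e IHe]; rewrite ?(fp.1 i).1 // !expgS (fp.1 i).2 IHe.
- split; first by have := hat 1%N isT; rewrite expg1.
  by exists w; split=> //; split; first by exists 1; rewrite conjg1 wE.
- exact: hat.
Qed.
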